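(* Let $\mathscr{T}$ be a finite simplicial decomposition of $K$, let $\tau>0$ be a time step, and let $(G^n)_{n\ge0}\subset\mathcal{A}_{\mathscr{T}}$ be a sequence such that for every $n\ge1$ the map $G^n$ is a global minimizer over $\mathcal{A}_{\mathscr{T}}$ of $G\mapsto \mathbf{E}_{\tau,\mathscr{T}}(G;G^{n-1})$. Let $\rho^n$, $\mathbf{v}^n$ be the induced densities and velocities and $\widetilde\rho$, $\widetilde{\mathbf{v}}$ their piecewise constant interpolations in time, as defined in the context. Then for any indices $\overline n>\underline n\ge0$, $$\mathcal{E}(\rho^{\overline n})+\frac{\tau}{2}\sum_{n=\underline n+1}^{\overline n}\left(\frac{\mathrm{W}_2(\rho^n,\rho^{n-1})}{\tau}\right)^2\le \mathcal{E}(\rho^{\underline n}).$$ Consequently: (1) $\mathcal{E}$ is monotonically decreasing, i.e. $\mathcal{E}(\widetilde\rho(t))\le\mathcal{E}(\widetilde\rho(s))$ for all $t\ge s\ge0$; (2) $\widetilde\rho$ is Hölder-$\frac12$-continuous in $\mathrm{W}_2$ up to an error controlled by $\tau$: $\mathrm{W}_2\big(\widetilde\rho(t),\widetilde\rho(s)\big)\le\sqrt{2\mathcal{E}(\rho^0)}\,\big(|t-s|^{1/2}+\tau^{1/2}\big)$ for all $t\ge s\ge0$; (3) $\widetilde{\mathbf{v}}$ is square integrable with respect to $\widetilde\rho$: for a time horizon $T>0$, $\displaystyle\int_0^T\int_{\mathbb{R}^d}\|\widetilde{\mathbf{v}}\|^2\,\widetilde\rho\,\mathrm{d}x\,\mathrm{d}t\le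 2\mathcal{E}(\rho^0)$.
   Context: Standing assumptions. $d\ge2$. $h\in C^1([0,\infty))\cap C^\infty((0,\infty))$ is non-negative and convex with $h(0)=h'(0)=0$ and $\lim_{s\to\infty}s\,h''(s)=+\infty$; $V\in C^2(\mathbb{R}^d)$ is non-negative. $\mathcal{P}_2^{\rm ac}(\mathbb{R}^d)$ is the set of probability densities on $\mathbb{R}^d$ with finite second moment, and $\mathrm{W}_2$ is the $L^2$-Wasserstein distance on it. $\overline\rho\in\mathcal{P}_2^{\rm ac}(\mathbb{R}^d)$ is a reference density whose support $K\subset\mathbb{R}^d$ is convex and compact. $G_\#\rho$ denotes the push-forward of $\rho$ under $G$ (absolutely continuous measures are identified with their densities). Entropy: $\mathcal{E}(\rho)=\int_{\mathbb{R}^d}[h(\rho(x))+V(x)\rho(x)]\,\mathrm{d}x$. Spatial discretization: $\mathscr{T}$ has $d$-simplices $\Delta_1,\dots,\Delta_M$. The density $\overline\rho_{\mathscr{T}}$ is constant on each $\Delta_m$ with value $\frac1{|\Delta_m|}\int_{\Delta_m}\overline\rho\,\mathrm{d}\omega$ (and zero outside $K$). $\mathcal{A}_{\mathscr{T}}$ is the set of continuous maps $G:K\to\mathbb{R}^d$ that on each $\Delta_m$ are affine, $G(\omega)=A_m\omega+b_m$, with $\det A_m>0$. Transformed entropy: with $\widetilde h(s)=s\,h(1/s)$ for $s>0$, $\mathbf{E}(G|\overline\rho_{\mathscr{T}})=\int_K\big[\widetilde h\big(\tfrac{\det \mathrm{D}G}{\overline\rho_{\mathscr{T}}}\big)+V\circ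 G\big]\overline\rho_{\mathscr{T}}\,\mathrm{d}\omega$ for $G\in\mathcal{A}_{\mathscr{T}}$. Time-step functional: $\mathbf{E}_{\tau,\mathscr{T}}(G;G^* )=\frac1{2\tau}\int_K\|G-G^*\|^2\overline\rho_{\mathscr{T}}\,\mathrm{d}\omega+\mathbf{E}(G|\overline\rho_{\mathscr{T}})$. Induced densities and velocities: $\rho^n=(G^n)_\#\overline\rho_{\mathscr{T}}$ for $n\ge0$, and for $n\ge1$, $\mathbf{v}^n=\frac1\tau\big(\mathrm{id}-G^{n-1}\circ(G^n)^{-1}\big)$ on the support of $\rho^n$, that is, on the image of $G^n$ (arbitrary values outside). Piecewise constant interpolations: $\widetilde\rho(t)=\rho^n$ and $\widetilde{\mathbf{v}}(t)=\mathbf{v}^n$ for $t\in((n-1)\tau,n\tau]$ (so $\widetilde\rho(0)=\rho^0$).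
   Formalization: The maps G^n with n≥1 are assumed injective on K, since the velocity v^n uses the inverse of G^n on its image, which is undefined for non-injective members of A_T; G^0 and the competing maps are not assumed injective. *)

(* Defs.v *)
From HB Require Import structures.
From mathcomp Require Import all_boot all_order all_algebra.
From mathcomp Require Import all_classical all_reals all_analysis.

Set Implicit Arguments.
Unset Strict Implicit.
Unset Printing Implicit Defensive.

Import Order.TTheory GRing.Theory Num.Theory.
Import numFieldNormedType.Exports.

Local Open Scope classical_set_scope.
Local Open Scope ring_scope.

(* Points of R^d are row vectors, so that a linear map acts as [x *m A] and
   ['J G x] is the matrix of the derivative in that convention.  The library
   norm of ['rV[R]_d] is the sup norm; it is used for topology only, and
   Euclidean distances go through [sqnorm]. *)

(* As for [n.-tuple T], the sigma-algebra of R^d is generated by the coordinate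
   maps. *)
Definition rV_display : measure_display -> measure_display.
Proof. exact. Qed.

Section measurable_rV.
Context (R : realType) (d : nat).

Let coord : 'I_d -> 'rV[R]_d -> R := fun i x => x ord0 i.

Let rV_set0 : g_sigma_preimage coord set0.
Proof. exact: sigma_algebra0. Qed.

Let rV_setC A : g_sigma_preimage coord A -> g_sigma_preimage coord (~` A).
Proof. exact: sigma_algebraC. Qed.

Let rV_bigcup (F : _^nat) : (forall i, g_sigma_preimage coord (F i)) ->
  g_sigma_preimage coord (\bigcup_i (F i)).
Proof. exact: sigma_algebra_bigcup. Qed.

HB.instance Definition _ := @isMeasurable.Build (rV_display default_measure_display)
  'rV[R]_d (g_sigma_preimage coord) rV_set0 rV_setC rV_bigcup.

End measurable_rV.

Lemma measurable_rV_coord (R : realType) d (i : 'I_d) :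
  measurable_fun [set: 'rV[R]_d] (fun x : 'rV[R]_d => x ord0 i).
Proof.
move=> _ Y mY; rewrite setTI; apply: sub_sigma_algebra => /=.
rewrite -bigcup_seq/=; exists i => /=; first by rewrite mem_index_enum.
by exists Y => //; rewrite setTI.
Qed.

Lemma measurable_fun_rV (R : realType) d d1 (T : measurableType d1)
    (f : T -> 'rV[R]_d) :
  (forall i, measurable_fun [set: T] (fun x => f x ord0 i)) ->
  measurable_fun [set: T] f.
Proof.
move=> mf; have mfA i (A : set R) : measurable A ->
    measurable (f @^-1` [set x | A (x ord0 i)]).
  by move=> mA; rewrite -[X in measurable X]setTI; exact: mf.
suff : @measurable _ 'rV[R]_d `<=` [set A | measurable (f @^-1` A)].
  by move=> sub _ A mA; rewrite setTI; exact: sub.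
apply: smallest_sub => [|A /=].
  split=> /=; first by rewrite preimage_set0.
    move=> A mA; rewrite (_ : f @^-1` _ = ~` (f @^-1` A)) ?setTD//.
      exact: measurableC.
  by move=> F mF; rewrite preimage_bigcup; exact: bigcup_measurable.
rewrite -bigcup_seq/= => -[i _ [B mB <-]].
by rewrite setTI; exact: mfA.
Qed.

(* R x R^d ~ R^d.+1 *)
Definition rV_cons (R : realType) d (z : measurableTypeR R * 'rV[R]_d) : 'rV[R]_d.+1 :=
  row_mx (const_mx z.1 : 'rV_1) z.2.

Lemma rV_cons0 (R : realType) d (z : measurableTypeR R * 'rV[R]_d) : rV_cons z ord0 ord0 = z.1.
Proof.
by rewrite /rV_cons mxE; case: splitP => //= j _; rewrite mxE.
Qed.

Lemma rV_consS (R : realType) d (z : measurableTypeR R * 'rV[R]_d) i :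
  rV_cons z ord0 (lift ord0 i) = z.2 ord0 i.
Proof.
rewrite /rV_cons mxE; case: splitP => /= j; first by rewrite ord1.
by rewrite /bump add1n => -[/val_inj ->].
Qed.

Lemma measurable_rV_cons (R : realType) d :
  measurable_fun [set: measurableTypeR R * 'rV[R]_d] (@rV_cons R d).
Proof.
apply: measurable_fun_rV => i; case: (unliftP ord0 i) => [j|] ->.
  under eq_fun do rewrite rV_consS.
  apply: (@measurableT_comp _ _ _ _ _ _ (fun x : 'rV[R]_d => x ord0 j)) => //.
  exact: measurable_rV_coord.
under eq_fun do rewrite rV_cons0.
exact: measurable_fst.
Qed.

Section lebesgue_rV_step.
Context (R : realType) (d : nat).
Variable mu : {sigma_finite_measure set 'rV[R]_d -> \bar R}.
Local Open Scope ereal_scope.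

Definition rV_measure_step : set 'rV[R]_d.+1 -> \bar R :=
  pushforward (@lebesgue_measure R \x mu) (@rV_cons R d).

Let mcons := @measurable_rV_cons R d.

Let step0 : rV_measure_step set0 = 0.
Proof. exact: measure0. Qed.

Let step_ge0 A : 0 <= rV_measure_step A.
Proof. exact: measure_ge0. Qed.

Let step_sigma_additive : semi_sigma_additive rV_measure_step.
Proof. exact: measure_semi_sigma_additive. Qed.

HB.instance Definition _ := isMeasure.Build _ _ _ rV_measure_step
  step0 step_ge0 step_sigma_additive.

Let rV_uncons (x : 'rV[R]_d.+1) : measurableTypeR R * 'rV[R]_d :=
  (x ord0 ord0, \row_i x ord0 (lift ord0 i)).

Let rV_consK : cancel (@rV_cons R d) rV_uncons.
Proof.
case=> a x; rewrite /rV_uncons rV_cons0; congr pair.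
by apply/rowP => i; rewrite mxE rV_consS.
Qed.

Let measurable_rV_uncons : measurable_fun [set: 'rV[R]_d.+1] rV_uncons.
Proof.
apply/measurable_fun_pairP; split; first exact: measurable_rV_coord.
apply: measurable_fun_rV => i /=.
under eq_fun do rewrite mxE.
exact: measurable_rV_coord.
Qed.

Let step_sigma_finite : sigma_finite setT rV_measure_step.
Proof.
have /sigma_finiteP[F [TF ndF Foo]] := sigma_finiteT (@lebesgue_measure R).
have /sigma_finiteP[G [TG ndG Goo]] := sigma_finiteT mu.
exists (fun k => rV_uncons @^-1` (F k `*` G k)).
  rewrite -preimage_bigcup (_ : \bigcup_k (F k `*` G k) = setT).
    by rewrite preimage_setT.
  rewrite -setXTT TF TG predeqE => -[x y]; split.
    by move=> [n _ []/= ? ?]; split; exists n.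
  move=> [/= [n _ Fnx] [k _ Gky]]; exists (maxn n k) => //; split.
  - by move: x Fnx; exact/subsetPset/ndF/leq_maxl.
  - by move: y Gky; exact/subsetPset/ndG/leq_maxr.
move=> k; have [mF Fk] := Foo k; have [mG Gk] := Goo k; split.
  rewrite -[X in measurable X]setTI; apply: measurable_rV_uncons => //.
  exact: measurableX.
rewrite /rV_measure_step /pushforward -comp_preimage.
rewrite (_ : _ \o _ = id); last by apply/funext => z; exact: rV_consK.
by rewrite preimage_id product_measure1E// lte_mul_pinfty// ge0_fin_numE.
Qed.

HB.instance Definition _ :=
  Measure_isSigmaFinite.Build _ _ _ rV_measure_step step_sigma_finite.

End lebesgue_rV_step.

(* Lebesgue measure on R^d, as the d-fold product of Lebesgue measure on R *)
Fixpoint lebesgue_rV (R : realType) (d : nat) :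
    {sigma_finite_measure set 'rV[R]_d -> \bar R} :=
  match d return {sigma_finite_measure set 'rV[R]_d -> \bar R} with
  | 0%N => dirac (0 : 'rV[R]_0)
  | d'.+1 => rV_measure_step (lebesgue_rV R d')
  end.

Lemma lebesgue_rV_box (R : realType) d (A : 'I_d -> set R) :
  (forall i, measurable (A i)) ->
  lebesgue_rV R d [set x | forall i, A i (x ord0 i)] =
  (\prod_(i < d) lebesgue_measure (A i))%E.
Proof.
elim: d A => [|d IHd] A mA /=.
  by rewrite big_ord0 diracE mem_set// => -[].
pose B := [set x : 'rV[R]_d | forall i, A (lift ord0 i) (x ord0 i)].
have mB : measurable B.
  rewrite (_ : B = \bigcap_(i in [set: 'I_d])
      [set x : 'rV[R]_d | A (lift ord0 i) (x ord0 i)]).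
    apply: fin_bigcap_measurable => // i _.
    by rewrite -[X in measurable X]setTI; exact: measurable_rV_coord.
  by apply/seteqP; split => x /= Bx i; [move=> _|]; exact: Bx.
rewrite big_ord_recl -(IHd (fun i => A (lift ord0 i)))// -/B.
rewrite -product_measure1E//; last exact: mA.
rewrite /rV_measure_step /pushforward.
rewrite (_ : _ @^-1` _ = A ord0 `*` B)//.
apply/seteqP; split => [z /= Az|z /= [A0 AS] i].
  by split=> [|i]; [have := Az ord0; rewrite rV_cons0
                   |have := Az (lift ord0 i); rewrite rV_consS].
by case: (unliftP ord0 i) => [j|] ->; rewrite ?rV_cons0 ?rV_consS//; exact: AS.
Qed.

Section admissible_data.
Context (R : realType).
Implicit Types (h dh : R -> R).

(* The difference quotients stay inside [0, +oo[, so the derivative at 0 is the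
   right one; [h] is irrelevant on negative numbers. *)
Definition has_derivative_ge0 h dh :=
  forall x, 0 <= x ->
    (fun y => (h y - h x) / (y - x)) @ within (fun y => 0 <= y) x^' --> dh x.

Definition smooth_density h :=
  (exists dh, [/\ has_derivative_ge0 h dh,
     {within `[0, +oo[, continuous dh} & dh 0 = 0]) /\
  forall n x, 0 < x -> derivable (derive1n n h) x 1.

Definition internal_energy_density h :=
  [/\ smooth_density h,
      forall s, 0 <= s -> 0 <= h s,
      convex_function (`[0, +oo[ : set R^o) h,
      h 0 = 0 &
      s * derive1n 2 h s @[s --> +oo] --> +oo].

Definition C1_fun d (f : 'rV[R]_d -> R) := forall i : 'I_d,
  (forall x, derivable f x (delta_mx ord0 i)) /\
  continuous ('D_(delta_mx ord0 i) f : 'rV[R]_d -> R).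

Definition C2_fun d (f : 'rV[R]_d -> R) :=
  C1_fun f /\ forall i : 'I_d, C1_fun ('D_(delta_mx ord0 i) f).

End admissible_data.

Section densities.
Context (R : realType) (d : nat).
Local Notation leb := (lebesgue_rV R d).
Implicit Types (rho sigma : 'rV[R]_d -> R).

Definition sqnorm (x : 'rV[R]_d) : R := \sum_(i < d) x ord0 i ^+ 2.

Definition P2ac rho :=
  [/\ measurable_fun [set: 'rV[R]_d] rho,
      forall x, 0 <= rho x,
      (\int[leb]_x (rho x)%:E = 1)%E &
      (\int[leb]_x (sqnorm x * rho x)%:E < +oo)%E].

(* support of the measure rho dx, insensitive to changes on null sets *)
Definition support_density rho : set 'rV[R]_d :=
  [set x | forall U, open U -> U x -> (0 < \int[leb]_(y in U) (rho y)%:E)%E].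

Definition coupling rho sigma
    (g : probability ('rV[R]_d * 'rV[R]_d)%type R) :=
  forall A : set 'rV[R]_d, measurable A ->
    g (A `*` setT) = (\int[leb]_(x in A) (rho x)%:E)%E /\
    g (setT `*` A) = (\int[leb]_(x in A) (sigma x)%:E)%E.

Definition W2 rho sigma : \bar R :=
  sqrte (ereal_inf
    [set (\int[g]_z (sqnorm (z.1 - z.2))%:E)%E | g in coupling rho sigma]).

(* [rho] is a density of the push-forward under [G] of the measure with density
   [rho0] on [K]; it is determined almost everywhere. *)
Definition pushforward_density (K : set 'rV[R]_d) (G : 'rV[R]_d -> 'rV[R]_d)
    rho0 rho :=
  [/\ measurable_fun [set: 'rV[R]_d] rho, forall x, 0 <= rho x &
      forall A, measurable A ->
        (\int[leb]_(x in A) (rho x)%:E =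
         \int[leb]_(w in K `&` G @^-1` A) (rho0 w)%:E)%E].

Definition entropy (h : R -> R) (V : 'rV[R]_d -> R) rho : \bar R :=
  (\int[leb]_x (h (rho x) + V x * rho x)%:E)%E.

End densities.

Section discretization.
Context (R : realType) (d M : nat).
Local Notation leb := (lebesgue_rV R d).
Implicit Types (K : set 'rV[R]_d) (G : 'rV[R]_d -> 'rV[R]_d).

Definition affinely_independent (v : 'I_d.+1 -> 'rV[R]_d) :=
  row_free (\matrix_(i < d) (v (lift ord0 i) - v ord0)).

(* convex hull of the vertices [v i], [i \in I] *)
Definition face (v : 'I_d.+1 -> 'rV[R]_d) (I : {set 'I_d.+1}) :
    set 'rV[R]_d :=
  [set x | exists w : 'I_d.+1 -> R,
    [/\ forall i, 0 <= w i, forall i, i \notin I -> w i = 0,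
        \sum_i w i = 1 & x = \sum_i w i *: v i]].

Definition simplex v := face v [set: 'I_d.+1].

(* [T m] lists the vertices of the m-th simplex.  Two simplices meet in a common
   face, possibly the empty one; as they are pairwise distinct, their interiors
   are then disjoint. *)
Definition simplicial_decomposition K (T : 'I_M -> 'I_d.+1 -> 'rV[R]_d) :=
  [/\ forall m, affinely_independent (T m),
      K = \bigcup_(m in [set: 'I_M]) simplex (T m),
      injective (fun m => simplex (T m)) &
      forall m m', exists I I' : {set 'I_d.+1},
        simplex (T m) `&` simplex (T m') = face (T m) I /\
        simplex (T m) `&` simplex (T m') = face (T m') I'].

(* A point of several simplices gets the value of the first one; these points
   form a null set. *)
Definition discrete_density (T : 'I_M -> 'I_d.+1 -> 'rV[R]_d)
    (rho : 'rV[R]_d -> R) (w : 'rV[R]_d) : R :=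
  if [pick m | w \in simplex (T m)] is Some m
  then fine (\int[leb]_(y in simplex (T m)) (rho y)%:E)%E
       / fine (leb (simplex (T m)))
  else 0.

(* Maps K -> R^d are represented by total functions whose values outside K are
   irrelevant. *)
Definition admissible_map K (T : 'I_M -> 'I_d.+1 -> 'rV[R]_d) G :=
  {within K, continuous G} /\
  forall m, exists (A : 'M[R]_d) (b : 'rV[R]_d),
    0 < \det A /\ forall w, simplex (T m) w -> G w = w *m A + b.

Definition htilde (h : R -> R) (s : R) : R := s * h s^-1.

(* ['J G w] is the Jacobian matrix of G at w, which is meaningful off the
   boundaries of the simplices, hence almost everywhere on K. *)
Definition transformed_entropy (h : R -> R) (V : 'rV[R]_d -> R) K
    (rhoT : 'rV[R]_d -> R) G : \bar R :=
  (\int[leb]_(w in K)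
     ((htilde h (\det ('J G w) / rhoT w) + V (G w)) * rhoT w)%:E)%E.

Definition step_functional (h : R -> R) (V : 'rV[R]_d -> R) K
    (rhoT : 'rV[R]_d -> R) (tau : R) G (Gs : 'rV[R]_d -> 'rV[R]_d) : \bar R :=
  (((2 * tau)^-1)%:E * \int[leb]_(w in K) (sqnorm (G w - Gs w) * rhoT w)%:E
   + transformed_entropy h V K rhoT G)%E.

End discretization.

(* Num.ceil (t / tau) is the n with t in ](n - 1) tau, n tau]. *)
Definition interpolation (R : realType) (X : Type) (tau : R) (u : nat -> X)
    (t : R) : X :=
  u `|Num.ceil (t / tau)|%N.

Lemma interpolationE (R : realType) (X : Type) (tau : R) (u : nat -> X)
    (n : nat) (t : R) :
  0 < tau -> (n%:R - 1) * tau < t -> t <= n%:R * tau ->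
  interpolation tau u t = u n.
Proof.
move=> tau0 lt le; rewrite /interpolation; congr u.
suff -> : Num.ceil (t / tau) = n%:Z by rewrite absz_nat.
by apply: ceil_def; rewrite ler_pdivrMr// ltr_pdivlMr// intrB le lt.
Qed.

Lemma interpolation0 (R : realType) (X : Type) (tau : R) (u : nat -> X) :
  interpolation tau u 0 = u 0%N.
Proof. by rewrite /interpolation mul0r ceil0. Qed.

(* Main.v *)
(* Testing the minimality of G^n against the competitor G^(n-1) bounds
   E(G^n) + |G^n - G^(n-1)|^2 / (2 tau) by E(G^(n-1)), where |.| is the L^2
   norm weighted by the discrete reference density; this telescopes.  On each
   simplex G^n is affine with positive determinant, so the linear change of
   variables shows that the induced density is, off a null set, the sum of
   constants r_m / det A_m on the images of the simplices.  If G^n is injective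
   these images overlap in a null set and the entropy of rho^n is E(G^n); the
   map G^0 need not be injective, but h is superadditive (it is convex with
   h(0) = 0), and E(G^0) is at most the entropy of rho^0, which is the direction
   needed.  The coupling (G^n, G^m)_# of the reference density bounds
   W_2(rho^n, rho^m); for the Hoelder estimate the chain from m to n is broken
   up inside this single coupling by Cauchy-Schwarz, so the triangle inequality
   for W_2 is not used. *)
Require Import Defs.
From HB Require Import structures.
From mathcomp Require Import all_boot all_order all_algebra fingroup perm.
From mathcomp Require Import all_classical all_reals all_analysis.
From mathcomp Require Import measurable_realfun ring lra.

Set Implicit Arguments.
Unset Strict Implicit.

Import Order.TTheory GRing.Theory Num.Theory.
Import numFieldNormedType.Exports.

Local Open Scope classical_set_scope.
Local Open Scope ring_scope.

(** * Integrals modulo null sets *)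

(** Three obstacles shape the proof. Integrals are therefore compared, off a null set, with
    integrands given by the affine formulas, through lemmas that do not ask for measurability. Next,
    Lebesgue measure on R^d is an iterated product, so the change of variables is built up from
    dimension one: Fubini treats triangular matrices, boxes treat permutations, and an LUP
    factorization combines them. Finally, entropies may be infinite, so the telescoping only adds in
    the extended reals and never subtracts. One null set, the union of the simplex boundaries,
    controls all overlaps: it is covered by finitely many hyperplanes and contains every point
    common to two distinct simplices. The constants come from the weight 1 / (2 tau) = (tau / 2)
    tau^-2; since the entropy is non-negative, the squared steps add up to at most 2 tau times the
    initial entropy, which feeds both the Hoelder and the velocity estimate. *)

Section null_sets.
Local Open Scope ereal_scope.
Context d (T : measurableType d) (R : realType).
Variable mu : {measure set T -> \bar R}.
Implicit Types (f g : T -> \bar R) (D N : set T).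

Import HBNNSimple.

(** The integral of a non-negative function is a supremum over simple functions below it. A simple
    function below [f], cut off on [N], lies below [g] and keeps its integral, so neither function
    has to be measurable. *)
Lemma ge0_le_integral_off_null D N f g : measurable N -> mu N = 0 ->
  (forall x, D x -> 0 <= f x) -> (forall x, D x -> 0 <= g x) ->
  (forall x, D x -> ~ N x -> f x <= g x) ->
  \int[mu]_(x in D) f x <= \int[mu]_(x in D) g x.
Proof.
move=> mN N0 f0 g0 fg; rewrite !ge0_integralE//.
apply: ge_ereal_sup => _ [s /= sf <-].
apply: le_ereal_sup_tmp.
exists (sintegral mu (proj_nnsfun s (measurableC mN))).
  exists (proj_nnsfun s (measurableC mN)) => //= x.
  rewrite /patch; case: ifPn => [/set_mem Dx|Dx].
    rewrite /= mindicE; have [/set_mem Nx|Nx] := boolP (x \in ~` N).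
      rewrite mulr1; apply: le_trans (fg _ Dx Nx).
      by have := sf x; rewrite /patch mem_set.
    by rewrite mulr0 g0.
  have := sf x; rewrite /patch (negbTE Dx) => sx.
  rewrite mindicE; case: (_ \in _); rewrite ?mulr1 ?mulr0//.
rewrite -!integralT_nnsfun.
have mE (h : {nnsfun T >-> R}) : \int[mu]_x (h x)%:E = \int[mu]_(x in setT `\`
  N) (h x)%:E.
  apply: ge0_negligible_integral => //; first exact/measurable_EFinP.
  by move=> x _; rewrite lee_fin.
rewrite !mE setTD le_eqVlt; apply/orP; left; apply/eqP.
by apply: eq_integral => x xN; rewrite /= mindicE xN mulr1.
Qed.

(* No measurability is assumed: ['J G] is junk on the boundaries of the
   simplices, and the velocity is arbitrary outside the image of G. *)
Lemma eq_integral_off_null D N f g : measurable N -> mu N = 0 ->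
  (forall x, D x -> ~ N x -> f x = g x) ->
  \int[mu]_(x in D) f x = \int[mu]_(x in D) g x.
Proof.
move=> mN N0 fg; rewrite integralE [RHS]integralE; congr (_ - _);
  apply/eqP; rewrite eq_le; apply/andP; split;
  by apply: (@ge0_le_integral_off_null _ N) => // x Dx Nx;
    rewrite ?funeposE ?funenegE fg.
Qed.

Lemma ge0_le_integral_gen D f g : (forall x, D x -> 0 <= f x) ->
  (forall x, D x -> f x <= g x) ->
  \int[mu]_(x in D) f x <= \int[mu]_(x in D) g x.
Proof.
move=> f0 fg; apply: (@ge0_le_integral_off_null _ set0) => // x Dx; last first.
  by move=> _; exact: fg.
exact: le_trans (f0 _ Dx) (fg _ Dx).
Qed.

Lemma ge0_integral_sum_patch (I : finType) (D : I -> set T)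
    (f : I -> T -> \bar R) :
  (forall i, measurable (D i)) -> (forall i, measurable_fun (D i) (f i)) ->
  (forall i x, D i x -> 0 <= f i x) ->
  \int[mu]_x (\sum_i (f i \_ (D i)) x) =
  \sum_i \int[mu]_(x in D i) f i x.
Proof.
move=> mD mf f0; rewrite ge0_integral_sum//.
- by apply: eq_bigr => i _; rewrite [RHS]integral_mkcond.
- by move=> i; apply/(measurable_restrictT _ (mD i)).
- by move=> i x _; rewrite /patch; case: ifPn => // /set_mem; exact: f0.
Qed.

Lemma bigsetU_null (I : Type) (s : seq I) (F : I -> set T) :
  (forall i, measurable (F i)) -> (forall i, mu (F i) = 0) ->
  mu (\big[setU/set0]_(i <- s) F i) = 0.
Proof.
move=> mF F0; elim: s => [|i s IH]; first by rewrite big_nil measure0.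
by rewrite big_cons null_set_setU//; exact: bigsetU_measurable.
Qed.

Lemma ge0_integral_mrestr D (mD : measurable D) f :
  measurable_fun setT f -> (forall x, 0 <= f x) ->
  \int[mrestr mu mD]_x f x = \int[mu]_(x in D) f x.
Proof.
move=> mf f0; have nD : mrestr mu mD (~` D) = 0.
  by rewrite /mrestr setICl measure0.
rewrite (ge0_negligible_integral (measurableC mD) measurableT)// setTD setCK.
by apply: eq_measure_integral => A mA AD; rewrite /= /mrestr setIidl.
Qed.

End null_sets.

(** * Linear change of variables *)

Definition pushforward_measure d1 d2 (T1 : measurableType d1)
    (T2 : measurableType d2) (R : realType) (m : {measure set T1 -> \bar R})
    (f : T1 -> T2) (mf : measurable_fun setT f) : {measure set T2 -> \bar R}.
Proof. by refine (pushforward m f : {measure set T2 -> \bar R}). Defined.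

Section measure_scaling_maps.
Local Open Scope ereal_scope.
Context d1 d2 (T1 : measurableType d1) (T2 : measurableType d2) (R : realType).
Variables (m1 : {measure set T1 -> \bar R}) (m2 : {measure set T2 -> \bar R}).
Variables (f : T1 -> T2) (k : {nonneg R}).
Hypothesis mf : measurable_fun setT f.
Hypothesis fk : forall E, measurable E -> m1 (f @^-1` E) = k%:num%:E * m2 E.

Lemma ge0_integral_scaling (D : set T2) (phi : T2 -> \bar R) :
  measurable D -> measurable_fun D phi -> (forall y, D y -> 0 <= phi y) ->
  \int[m1]_(x in f @^-1` D) phi (f x) = k%:num%:E * \int[m2]_(y in D) phi y.
Proof.
move=> mD mphi phi0.
rewrite -(ge0_integral_pushforward mf _ mD mphi); last first.
  by move=> y /set_mem; exact: phi0.
rewrite -ge0_integral_mscale//; apply: eq_measure_integral => A mA _.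
by rewrite /= /pushforward fk.
Qed.

End measure_scaling_maps.

(** By uniqueness of Lebesgue measure: the push-forward under the affine map, scaled by [|a|], gives
    half-open intervals their length. *)
Lemma lebesgue_measure_affine (R : realType) (a b : R) (E : set R) :
  a != 0 -> measurable E ->
  lebesgue_measure ((fun x => x * a + b) @^-1` E : set (measurableTypeR R)) =
  (`|a|^-1%:E * lebesgue_measure E)%E.
Proof.
move=> a0 mE.
have mf : measurable_fun [set: measurableTypeR R]
    (fun x => x * a + b : measurableTypeR R).
  by apply: measurable_funD => //; exact: measurable_funM.
have a0' : 0 <= `|a| by [].
have : lebesgue_measure E =
    mscale (NngNum a0') (pushforward_measure (@lebesgue_measure R) mf) E.
  apply: lebesgue_measure_unique => // _ [[l r] _ <-].
  rewrite /= /mscale /= /pushforward.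
  have [ap|an] : 0 < a \/ a < 0 by apply/orP; rewrite -neq_lt eq_sym.
    rewrite (_ : _ @^-1` _ = `](l - b) / a, (r - b) / a]%classic); last first.
      apply/seteqP; split => x /=; rewrite !in_itv/=.
        by rewrite ltr_pdivrMr// ler_pdivlMr// ltrBlDr lerBrDr.
      by rewrite ltr_pdivrMr// ler_pdivlMr// ltrBlDr lerBrDr.
    rewrite !lebesgue_measure_itv/= !lte_fin ltr_pM2r ?invr_gt0// ltrD2r.
    case: ifPn => _; last by rewrite mule0.
    rewrite -!EFinD -EFinM gtr0_norm//; congr EFin; field.
    by rewrite gt_eqF.
  (* A negative slope reverses the interval, so the closed end moves to the left; the length is
     unaffected. *)
  rewrite (_ : _ @^-1` _ = `[(r - b) / a, (l - b) / a[%classic); last first.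
    apply/seteqP; split => x /=; rewrite !in_itv/=.
      by rewrite ltr_ndivlMr// ler_ndivrMr// ltrBlDr lerBrDr andbC.
    by rewrite ltr_ndivlMr// ler_ndivrMr// ltrBlDr lerBrDr andbC.
  rewrite !lebesgue_measure_itv/= !lte_fin ltr_nM2r ?invr_lt0// ltrD2r.
  case: ifPn => _; last by rewrite mule0.
  rewrite -!EFinD -EFinM ltr0_norm//; congr EFin; field.
  by rewrite lt_eqF.
rewrite /= /mscale /= /pushforward => ->.
by rewrite muleA -EFinM mulVf ?normr_eq0// mul1e.
Qed.

Section linear_change_of_variables.
Context (R : realType).
Implicit Types (d : nat).

Lemma measurable_affine m n (A : 'M[R]_(m, n)) (b : 'rV[R]_n) :
  measurable_fun [set: 'rV[R]_m] (fun x => x *m A + b : 'rV[R]_n).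
Proof.
apply: measurable_fun_rV => j; under eq_fun do rewrite !mxE.
apply: measurable_funD => //; apply: measurable_sum => i.
by apply: measurable_funM => //; exact: measurable_rV_coord.
Qed.

Lemma measurable_preimage_affine m n (A : 'M[R]_(m, n)) (b : 'rV[R]_n) E :
  measurable E -> measurable ((fun x : 'rV[R]_m => x *m A + b) @^-1` E).
Proof. by move=> mE; rewrite -[X in measurable X]setTI;
  exact: measurable_affine. Qed.

(** All translations are included because slicing a triangular map along its first coordinate leaves
    a smaller map whose translation depends on that coordinate. *)
Definition scales_lebesgue d (A : 'M[R]_d) := forall (b : 'rV[R]_d) E,
  measurable E ->
  lebesgue_rV R d ((fun x => x *m A + b) @^-1` E) =
  (`|\det A|^-1%:E * lebesgue_rV R d E)%E.

Lemma scales_lebesgue_mul d (A B : 'M[R]_d) :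
  scales_lebesgue A -> scales_lebesgue B -> scales_lebesgue (A *m B).
Proof.
move=> sA sB b E mE; rewrite det_mulmx normrM invfM EFinM -muleA -(sB b)//.
rewrite -(sA 0)//; last exact: measurable_preimage_affine.
by congr (lebesgue_rV R d _); apply/funext => x /=; rewrite addr0 mulmxA.
Qed.

Lemma rV_cons_affine d (A : 'M[R]_(1 + d)) (b : 'rV[R]_(1 + d)) t (y : 'rV[R]_d) :
  dlsubmx A = 0 ->
  rV_cons (t, y) *m A + b =
  rV_cons (t * A ord0 ord0 + b ord0 ord0,
           y *m drsubmx A + (t *: ursubmx A + rsubmx b)).
Proof.
move=> A0; have -> : rV_cons (t, y) *m A = row_mx ((const_mx t : 'rV[R]_1) *m
  ulsubmx A)
    ((const_mx t : 'rV[R]_1) *m ursubmx A + y *m drsubmx A) :> 'rV[R]_(1 + d).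
  rewrite -[in LHS](submxK A) A0; have := mul_row_block (const_mx t : 'rV[R]_1) y
    (ulsubmx A) (ursubmx A) 0 (drsubmx A).
  by rewrite mulmx0 addr0.
rewrite -[b in LHS]hsubmxK add_row_mx; congr row_mx.
  apply/rowP => i; rewrite !ord1 !mxE big_ord1 !mxE.
  by congr (_ * A _ _ + b _ _); apply/val_inj.
rewrite addrA; congr (_ + _); rewrite addrC; congr (_ + _).
by apply/rowP => i; rewrite !mxE big_ord1 !mxE.
Qed.

(** Fubini and induction on the dimension. With row vectors, the first output coordinate depends on
    the first input coordinate alone; the slices contribute the determinant of the lower right
    block, and the outer integral is a one-dimensional affine substitution. *)
Lemma scales_lebesgue_upper d (A : 'M[R]_d) :
  (forall i j : 'I_d, (j < i)%N -> A i j = 0) -> \det A != 0 ->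
  scales_lebesgue A.
Proof.
elim: d A => [|d IH] A A0 detA b E mE.
  rewrite det_mx00 normr1 invr1 mul1e; congr (lebesgue_rV R 0 _).
  by apply/seteqP; split => x /=;
    rewrite (_ : x *m A + b = x)// [LHS]thinmx0 [RHS]thinmx0.
pose A' : 'M[R]_(1 + d) := A.
have Adl : dlsubmx A' = 0.
  by apply/matrixP => i j; rewrite !mxE A0//= ord1.
have detE : \det A = A ord0 ord0 * \det (drsubmx A').
  have := det_ublock (ulsubmx A') (ursubmx A') (drsubmx A').
  rewrite -Adl submxK => ->; congr (_ * _).
  by rewrite [ulsubmx A']mx11_scalar det_scalar1 !mxE; congr (A _ _);
    apply/val_inj.
move: detA; rewrite detE mulf_eq0 negb_or => /andP[a0 detB].
have {}IH := IH (drsubmx A') _ detB.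
have {}IH : scales_lebesgue (drsubmx A').
  by apply: IH => i j ij; rewrite !mxE A0.
pose S := (@rV_cons R d) @^-1` E.
have mS : measurable S.
  by rewrite -[X in measurable X]setTI; exact: measurable_rV_cons.
rewrite /= /rV_measure_step /pushforward.
rewrite [LHS]/product_measure1/=.
transitivity (\int[@lebesgue_measure R]_t (`|\det (drsubmx A')|^-1%:E *
   lebesgue_rV R d (xsection S (t * A ord0 ord0 + b ord0 ord0)%R)))%E.
  apply: eq_integral => t _.
  rewrite -(IH (t *: ursubmx A' + rsubmx (b : 'rV_(1 + d))));
    last exact: measurable_xsection.
  congr (lebesgue_rV R d _); apply/seteqP; split => y;
    rewrite /xsection /= !inE /S /preimage /=.
    by rewrite (@rV_cons_affine d A').
  by rewrite (@rV_cons_affine d A').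
have mphi : measurable_fun [set: measurableTypeR R] (lebesgue_rV R d \o
  xsection S).
  exact: measurable_fun_xsection.
rewrite ge0_integralZl//; last first.
  apply: (@measurableT_comp _ _ _ _ _ _ (lebesgue_rV R d \o xsection S)) => //.
  by apply: measurable_funD => //; exact: measurable_funM.
have k0 : 0 <= `|A ord0 ord0|^-1 by rewrite invr_ge0.
rewrite -[X in (\int[_]_(_ in X) _)%E](preimage_setT (fun t : R => t * A ord0
  ord0 + b ord0 ord0)).
rewrite (@ge0_integral_scaling _ _ (measurableTypeR R) (measurableTypeR R) R
  lebesgue_measure lebesgue_measure
  (fun t => t * A ord0 ord0 + b ord0 ord0) (NngNum k0) _ _ _
  (lebesgue_rV R d \o xsection S))//=; last 2 first.
- by apply: measurable_funD => //; exact: measurable_funM.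
- by move=> D mD; exact: lebesgue_measure_affine.
by rewrite muleA -EFinM normrM invfM mulrC.
Qed.

End linear_change_of_variables.

Section invertible_matrices.
Context (R : realType).
Implicit Types (d : nat).

Definition rV_box d (A : 'I_d -> set R) : set 'rV[R]_d :=
  [set x | forall i, A i (x ord0 i)].

Lemma measurable_rV_box d (A : 'I_d -> set R) :
  (forall i, measurable (A i)) -> measurable (rV_box A).
Proof.
move=> mA; rewrite (_ : rV_box A = \bigcap_(i in [set: 'I_d])
    [set x : 'rV[R]_d | A i (x ord0 i)]).
  apply: fin_bigcap_measurable => // i _.
  by rewrite -[X in measurable X]setTI; exact: measurable_rV_coord.
by apply/seteqP; split => x /= Ax i; [move=> _|]; exact: Ax.
Qed.

(** Boxes are stable under intersection and generate the sigma-algebra, and the cubes [[- k, k]^d]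
    exhaust the space with finite measure. *)
Lemma lebesgue_rV_unique d (m : {measure set 'rV[R]_d -> \bar R}) E :
  (forall A : 'I_d -> set R, (forall i, measurable (A i)) ->
    m (rV_box A) = lebesgue_rV R d (rV_box A)) ->
  measurable E -> m E = lebesgue_rV R d E.
Proof.
move=> mbox mE; apply/esym.
pose boxes := [set X : set 'rV[R]_d |
  exists2 A : 'I_d -> set R, (forall i, measurable (A i)) & X = rV_box A].
apply: (@measure_unique _ R _ boxes
  (fun k => rV_box (fun _ => `[- k%:R, k%:R]%classic))) => //.
- apply/seteqP; split.
    apply: smallest_sub; first exact: smallest_sigma_algebra.
    move=> X; rewrite -bigcup_seq/= => -[i _ [B mB <-]]; rewrite setTI.
    apply: sub_sigma_algebra.
    exists (fun j => if j == i then B else setT).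
      by move=> j; case: ifP.
    apply/seteqP; split => x /=; first by move=> Bx j; case: eqP => // ->.
    by move=> /(_ i); rewrite eqxx.
  apply: smallest_sub; first exact: sigma_algebra_measurable.
  by move=> X [A mA ->]; exact: measurable_rV_box.
- move=> _ _ [A mA ->] [B mB ->]; exists (fun i => A i `&` B i).
    by move=> i; exact: measurableI.
  apply/seteqP; split => x /=; first by move=> [Ax Bx] i; split.
  by move=> ABx; split=> i; have [] := ABx i.
- by move=> k; exists (fun _ => `[- k%:R, k%:R]%classic).
- apply/seteqP; split => // x _.
  exists (Num.truncn (\sum_i `|x ord0 i|)).+1 => // i /=.
  rewrite in_itv/= -ler_norml.
  apply: le_trans (ltW (truncnS_gt _)).
  by rewrite (bigD1 i)//= lerDl sumr_ge0.
- by move=> _ [A mA ->]; rewrite mbox.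
- move=> k.
  suff : (lebesgue_rV R d (rV_box (fun _ => `[- k%:R, k%:R]%classic)%R) <
    +oo)%E by [].
  rewrite lebesgue_rV_box; last by move=> i; exact: measurable_itv.
  rewrite (eq_bigr (fun=> (k%:R + k%:R)%:E)) => [|i _]; last first.
    rewrite lebesgue_measure_itv/= lte_fin -EFinB opprK.
    case: ifPn => //; rewrite -leNgt => kk; congr EFin.
    have k0 : 0 <= k%:R :> R by [].
    lra.
  by rewrite prodEFin ltry.
Qed.

Lemma lebesgue_rV_translate d (b : 'rV[R]_d) E : measurable E ->
  lebesgue_rV R d ((fun x => x + b) @^-1` E) = lebesgue_rV R d E.
Proof.
move=> mE.
have /(_ b E mE) : scales_lebesgue (1%:M : 'M[R]_d).
  apply: scales_lebesgue_upper => [i j ij|]; last by rewrite det1 oner_neq0.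
  by rewrite mxE; case: eqP ij => // ->; rewrite ltnn.
rewrite det1 normr1 invr1 mul1e => <-; congr (lebesgue_rV R d _).
by apply/funext => x /=; rewrite mulmx1.
Qed.

(** A permutation of coordinates only reorders the sides of a box, hence the factors of its
    volume. *)
Lemma scales_lebesgue_perm d (s : 'S_d) : scales_lebesgue (perm_mx s : 'M[R]_d).
Proof.
move=> b E mE.
rewrite det_perm normrX normrN normr1 expr1n invr1 mul1e.
rewrite -(lebesgue_rV_translate b mE).
have mf := @measurable_affine R d d (perm_mx s) 0.
set E' : set 'rV[R]_d := (fun x => x + b) @^-1` E.
have mE' : measurable E'.
  rewrite [X in measurable X](_ : _ = (fun x : 'rV[R]_d => x *m 1%:M + b)
    @^-1` E).
    exact: measurable_preimage_affine.
  by apply/funext => x /=; rewrite /E' /preimage/= mulmx1.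
rewrite -(@lebesgue_rV_unique d (pushforward_measure (lebesgue_rV R d) mf) E')//.
  rewrite /= /pushforward; congr (lebesgue_rV R d _).
  by apply/funext => x /=; rewrite /E' /preimage/= addr0.
move=> A mA; rewrite /= /pushforward.
transitivity (lebesgue_rV R d (rV_box (A \o s))).
  congr (lebesgue_rV R d _); apply/seteqP; split => x /= Ax i.
    have := Ax (s i); rewrite addr0 -[s in x *m perm_mx s]invgK -col_permE mxE.
    by rewrite permK.
  rewrite addr0 -[s in x *m perm_mx s]invgK -col_permE mxE.
  by have := Ax ((s^-1)%g i); rewrite /= permKV.
rewrite /rV_box !lebesgue_rV_box//; last by move=> i; exact: mA.
by rewrite [RHS](reindex_inj (@perm_inj _ s)).
Qed.

(** Conjugation by the order-reversing permutation turns a lower triangular matrix into an upper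
    triangular one. *)
Lemma scales_lebesgue_lower d (A : 'M[R]_d) :
  (forall i j : 'I_d, (i < j)%N -> A i j = 0) -> \det A != 0 ->
  scales_lebesgue A.
Proof.
move=> A0 detA.
pose w := perm (@rev_ord_inj d).
have wP : perm_mx w *m perm_mx w = 1%:M :> 'M[R]_d.
  rewrite -perm_mxM (_ : (w * w)%g = 1%g) ?perm_mx1//.
  by apply/permP => i; rewrite permM !permE rev_ordK.
have -> : A = perm_mx w *m (perm_mx w *m A *m perm_mx w) *m perm_mx w.
  by rewrite !mulmxA wP mul1mx -mulmxA wP mulmx1.
apply: scales_lebesgue_mul; last exact: scales_lebesgue_perm.
apply: scales_lebesgue_mul; first exact: scales_lebesgue_perm.
apply: scales_lebesgue_upper => [i j ij|].
  have wV : (w^-1)%g = w.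
    by apply/permP => k; apply: (@perm_inj _ w); rewrite permKV !permE rev_ordK.
  rewrite -[w in X in X = _]wV -col_permE -row_permE wV !mxE !permE.
  by apply: A0; apply: ltn_sub2l => //; exact: leq_ltn_trans ij (ltn_ord i).
rewrite !det_mulmx mulf_neq0 ?mulf_neq0//;
  by rewrite det_perm signr_eq0.
Qed.

Lemma scales_lebesgueT d (A : 'M[R]_d) : \det A != 0 -> scales_lebesgue A.
Proof.
(* The LUP factorization is stated for positive size, so size 0 is treated as a triangular case. *)
case: d A => [|d] A detA; first by apply: scales_lebesgue_upper => // -[].
case E : (cormen_lup A) => [[P L] U].
have := cormen_lup_correct A; rewrite E /= => PA.
have := cormen_lup_perm A; rewrite E /= => /is_perm_mxP[s Ps].
have := cormen_lup_lower A; rewrite E /= => Llow.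
have := cormen_lup_upper A; rewrite E /= => Uup.
have := cormen_lup_detL A; rewrite E /= => detL.
have Au : A = perm_mx (s^-1)%g *m (L *m U).
  by rewrite -[L *m U]PA [_ * A]/(P *m A) Ps mulmxA -perm_mxM mulVg perm_mx1
    mul1mx.
rewrite Au; apply: scales_lebesgue_mul; first exact: scales_lebesgue_perm.
apply: scales_lebesgue_mul.
  apply: scales_lebesgue_lower; last by rewrite detL oner_neq0.
  by move=> i j ij; rewrite Llow ?(ltnW ij)//; case: eqP ij => // ->;
    rewrite ltnn.
apply: scales_lebesgue_upper => //.
apply: contraNneq detA => detU.
by rewrite Au !det_mulmx detU !mulr0.
Qed.

End invertible_matrices.

(** * Simplices and barycentric coordinates *)

Section null_hyperplanes.
Context (R : realType).

(** Induction by slicing: if [a] has a non-zero entry beyond the first, every slice is a hyperplane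
    of lower dimension; otherwise the set is a point times a whole space, null because 0 times
    infinity is 0. *)
Lemma lebesgue_rV_hyperplane d (a : 'cV[R]_d) (c : R) : a != 0 ->
  lebesgue_rV R d [set x | (x *m a) ord0 ord0 = c] = 0%E.
Proof.
elim: d a c => [|d IH] a c a0; first by rewrite flatmx0 eqxx in a0.
pose a' : 'cV[R]_d := \col_j a (lift ord0 j) ord0.
have conse t (y : 'rV[R]_d) :
    (rV_cons (t, y) *m a) ord0 ord0 = t * a ord0 ord0 + (y *m a') ord0 ord0.
  rewrite !mxE big_ord_recl rV_cons0; congr (_ + _).
  by apply: eq_bigr => j _; rewrite rV_consS !mxE.
rewrite /= /rV_measure_step /pushforward.
have [a'0|a'0] := eqVneq a' 0.
  have a00 : a ord0 ord0 != 0.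
    apply: contraNneq a0 => a00; apply/eqP/matrixP => i j; rewrite ord1 mxE.
    case: (unliftP ord0 i) => [k|] -> //.
    by have /matrixP/(_ k ord0) := a'0; rewrite !mxE.
  rewrite (_ : _ @^-1` _ = [set c / a ord0 ord0] `*` setT); last first.
    apply/seteqP; split => -[t y] /=; rewrite conse a'0 mulmx0 mxE addr0.
      by move=> <-; split => //; rewrite mulfK.
    by move=> [-> _]; rewrite divfK.
  have m1 : measurable ([set c / a ord0 ord0] : set (measurableTypeR R)).
    exact: measurable_set1.
  rewrite product_measure1E//.
  rewrite [X in (X * _)%E](_ : _ = 0%E) ?mul0e//.
  exact: lebesgue_measure_set1.
rewrite /product_measure1; apply: integral0_eq => t _ /=.
rewrite -[RHS](IH a' (c - t * a ord0 ord0) a'0); congr (lebesgue_rV R d _).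
apply/seteqP; split => y; rewrite /xsection /= inE /= conse.
  by move=> <-; rewrite addrC addKr.
by move=> ->; rewrite addrC subrK.
Qed.

End null_hyperplanes.

Section barycentric.
Context (R : realType) (d : nat) (v : 'I_d.+1 -> 'rV[R]_d).
Hypothesis vfree : affinely_independent v.

Let E := \matrix_(i < d) (v (lift ord0 i) - v ord0).

Let Eu : E \in unitmx.
Proof. by rewrite -row_free_unit. Qed.

(** Barycentric coordinates as affine functions on the whole space: the coordinates of [x - v ord0]
    in the basis of edge vectors, completed at [ord0] so that the total is 1. *)
Definition bary (i : 'I_d.+1) (x : 'rV[R]_d) : R :=
  let l := (x - v ord0) *m invmx (\matrix_(i < d) (v (lift ord0 i) - v ord0)) in
  if unlift ord0 i is Some j then l ord0 j else 1 - \sum_j l ord0 j.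

Lemma sum_bary x : \sum_i bary i x = 1.
Proof.
rewrite big_ord_recl /bary unlift_none.
rewrite [X in _ + X](_ : _ = \sum_j ((x - v ord0) *m invmx E) ord0 j) ?subrK//.
by apply: eq_bigr => j _; rewrite liftK.
Qed.

Lemma bary_comb (w : 'I_d.+1 -> R) i : \sum_i w i = 1 ->
  bary i (\sum_i w i *: v i) = w i.
Proof.
move=> w1; have lE : (\sum_i w i *: v i - v ord0) *m invmx E =
    \row_j w (lift ord0 j).
  apply: (canLR (mulmxK Eu)); rewrite mulmx_sum_row.
  rewrite big_ord_recl -[X in _ - X]scale1r -w1 big_ord_recl scalerDl opprD
    addrACA subrr add0r.
  rewrite scaler_suml -sumrB; apply: eq_bigr => j _.
  by rewrite mxE rowK scalerBr.
rewrite /bary lE; case: (unliftP ord0 i) => [j|] ->; first by rewrite mxE.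
under eq_bigr do rewrite mxE.
by rewrite -w1 big_ord_recl addrK.
Qed.

Lemma bary_decomp x : x = \sum_i bary i x *: v i.
Proof.
set y := RHS; have : (x - v ord0) *m invmx E = (y - v ord0) *m invmx E.
  apply/rowP => j.
  have := bary_comb (lift ord0 j) (sum_bary x).
  by rewrite -/y /bary liftK => <-.
by move=> /(can_inj (mulmxKV Eu))/addIr.
Qed.

Lemma bary_vertex i j : bary i (v j) = (i == j)%:R.
Proof.
rewrite -[v j]scale1r (_ : 1 *: v j = \sum_k (k == j)%:R *: v k).
  by rewrite bary_comb// (bigD1 j)//= eqxx big1 ?addr0// => k /negbTE ->.
rewrite (bigD1 j)//= eqxx big1 ?addr0// => k /negbTE ->.
by rewrite scale0r.
Qed.

Lemma bary_affine i :
  exists (a : 'cV[R]_d) c, forall x, bary i x = (x *m a) ord0 ord0 + c.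
Proof.
rewrite /bary; case: unlift => [j|].
  exists (col j (invmx E)), (- (v ord0 *m invmx E) ord0 j) => x.
  by rewrite colE mulmxA -colE mulmxBl mxE [X in _ + X]mxE [X in _ = X - _]mxE.
exists (- (invmx E *m const_mx 1)), (1 + (v ord0 *m invmx E *m (const_mx 1 :
  'cV_d)) ord0 ord0) => x.
have sE (y : 'rV[R]_d) : \sum_j y ord0 j = (y *m (const_mx 1 : 'cV_d)) ord0 ord0.
  by rewrite mxE; apply: eq_bigr => j _; rewrite mxE mulr1.
rewrite sE -/E mulmxBl mulmxN mulmxBl !mulmxA [RHS]addrC !mxE.
by rewrite opprB -!addrA; congr (_ + _); rewrite [RHS]addrC.
Qed.

Lemma simplexP x : simplex v x <-> forall i, 0 <= bary i x.
Proof.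
split=> [[w [w0 _ w1 ->]] i|b0]; first by rewrite bary_comb.
exists (bary^~ x); split => //; [by move=> i; rewrite inE|exact: sum_bary|].
exact: bary_decomp.
Qed.

Lemma bary_face I x i : face v I x -> i \notin I -> bary i x = 0.
Proof. by move=> [w [w0 wI w1 ->]] iI; rewrite bary_comb// wI. Qed.

(** The interior of the simplex in barycentric form, which gives measurability and openness directly
    and places the boundary in the zero sets of the coordinates. *)
Definition open_simplex : set 'rV[R]_d := [set x | forall i, 0 < bary i x].

Lemma measurable_bary i : measurable_fun [set: 'rV[R]_d] (bary i).
Proof.
have [a [c ac]] := bary_affine i.
rewrite (_ : bary i = (fun y : 'rV[R]_1 => y ord0 ord0) \o
    (fun x => x *m a + const_mx c)).
  apply: measurableT_comp; first exact: measurable_rV_coord.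
  exact: measurable_affine.
by apply/funext => x /=; rewrite ac [RHS]mxE [X in _ = _ + X]mxE.
Qed.

Lemma measurable_simplex : measurable (simplex v).
Proof.
rewrite (_ : simplex v = \bigcap_(i in [set: 'I_d.+1]) (bary i @^-1` `[0, +oo[)).
  apply: fin_bigcap_measurable => // i _.
  by rewrite -[X in measurable X]setTI; exact: measurable_bary.
apply/seteqP; split => x; first by move=> /simplexP b0 i _ /=;
  rewrite in_itv/= b0.
by move=> b0; apply/simplexP => i; have := b0 i Logic.I;
  rewrite /= in_itv/= andbT.
Qed.

Lemma open_simplex_sub : open_simplex `<=` simplex v.
Proof. by move=> x x0; apply/simplexP => i; exact/ltW. Qed.

Lemma measurable_open_simplex : measurable open_simplex.
Proof.
rewrite (_ : open_simplex = \bigcap_(i in [set: 'I_d.+1]) (bary i @^-1` `]0,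
  +oo[)).
  apply: fin_bigcap_measurable => // i _.
  by rewrite -[X in measurable X]setTI; exact: measurable_bary.
apply/seteqP; split => x; first by move=> b0 i _ /=; rewrite in_itv/= b0.
by move=> b0 i; have := b0 i Logic.I; rewrite /= in_itv/= andbT.
Qed.

Lemma lebesgue_bary_eq0 i : (0 < d)%N ->
  lebesgue_rV R d [set x | bary i x = 0] = 0%E.
Proof.
move=> d0; have [a [c ac]] := bary_affine i.
rewrite (_ : [set _ | _] = [set x | (x *m a) ord0 ord0 = - c]).
  apply: lebesgue_rV_hyperplane; apply/eqP => a0.
  (* The linear part [a] cannot vanish, since [bary i] is 1 at vertex i and 0 at another vertex,
     which exists because the dimension is positive. *)
  have [j ij] : exists j, j != i.
    case: d d0 i {a ac a0} => // n _ i.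
    case: (eqVneq i ord0) => [->|i0]; last by exists ord0; rewrite eq_sym.
    by exists ord_max.
  have := bary_vertex i i; have := bary_vertex i j.
  rewrite !ac a0 !mulmx0 !mxE eqxx eq_sym (negbTE ij) => -> /eqP.
  by rewrite eq_sym oner_eq0.
apply/seteqP; split => x /=; rewrite ac; first by move/eqP;
  rewrite addr_eq0 => /eqP.
by move=> ->; rewrite addNr.
Qed.

Lemma simplex_boundary_null : (0 < d)%N ->
  lebesgue_rV R d (simplex v `\` open_simplex) = 0%E.
Proof.
move=> d0; have mi i : measurable [set x | bary i x = 0].
  rewrite [X in measurable X](_ : _ = bary i @^-1` [set 0])//.
  by rewrite -[X in measurable X]setTI; exact: measurable_bary.
apply: (@subset_measure0 _ _ _ _ _ (\big[setU/set0]_(i < d.+1) [set x | bary i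
  x = 0])).
- by apply: measurableD;
    [exact: measurable_simplex|exact: measurable_open_simplex].
- exact: bigsetU_measurable.
- move=> x [/simplexP b0 nb]; apply: contrapT => nx; apply: nb => i.
  rewrite lt_neqAle b0 andbT; apply/eqP => b00; apply: nx.
  by rewrite -bigcup_seq; exists i => //=; rewrite mem_index_enum.
- by apply: bigsetU_null => // i; exact: lebesgue_bary_eq0.
Qed.

End barycentric.

(** * Continuity and Jacobians of affine maps *)

Section affine_maps.
Context (R : numFieldType).

Lemma continuous_rV (T : topologicalType) n (f : T -> 'rV[R]_n) :
  (forall j, continuous (fun x => f x ord0 j)) -> continuous f.
Proof.
move=> cf x; apply/cvg_ballP => e e0.
have : \forall y \near x, forall j, ball (f x ord0 j) e (f y ord0 j).
  by apply: filter_forall => j; apply: (cf j x); exact: nbhsx_ballx.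
apply: filterS => y fy; split => // i j; rewrite !ord1; exact: fy.
Qed.

Lemma continuous_affine m n (A : 'M[R]_(m, n)) (b : 'rV[R]_n) :
  continuous (fun x : 'rV[R]_m => x *m A + b : 'rV[R]_n).
Proof.
apply: continuous_rV => j.
have cs (s : seq 'I_m) :
    continuous (fun x : 'rV[R]_m => \sum_(k <- s) x ord0 k * A k j).
  elim: s => [|k s IH].
    rewrite (_ : (fun _ => _) = cst 0); first exact: cst_continuous.
    by apply/funext => x; rewrite big_nil.
  rewrite (_ : (fun _ => _) = (fun x : 'rV[R]_m => x ord0 k * A k j) \+
      (fun x => \sum_(k <- s) x ord0 k * A k j)); last first.
    by apply/funext => x; rewrite big_cons.
  move=> x; apply: continuousD; last exact: IH.
  apply: (@continuousM _ _ _ (cst (A k j))); last exact: cst_continuous.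
  exact: coord_continuous.
rewrite (_ : (fun _ => _) = (fun x : 'rV[R]_m =>
    \sum_k x ord0 k * A k j + b ord0 j)); last by apply/funext => x; rewrite !mxE.
by move=> x; apply: continuousD; [exact: cs|exact: cst_continuous].
Qed.

Lemma jacobian_near_affine n (A : 'M[R]_n) (b : 'rV[R]_n)
    (G : 'rV[R]_n -> 'rV[R]_n) w :
  (\forall x \near w, G x = x *m A + b) -> 'J G w = A.
Proof.
move=> GA.
suff dG : 'd G w = mulmxr A :> (_ -> _).
  by apply/row_matrixP => i; rewrite /jacobian !rowE mul_rV_lin1 dG.
apply: (@diff_unique _ _ _ G (mulmxr A) w).
  have cA : continuous (fun x : 'rV[R]_n => x *m A).
    rewrite (_ : (fun _ => _) = (fun x : 'rV[R]_n => x *m A + 0)).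
      exact: continuous_affine.
    by apply/funext => x; rewrite addr0.
  exact: cA.
apply/eqaddoP => e e0.
have GAh : \forall h \near (0 : 'rV[R]_n), G (h + w) = (h + w) *m A + b.
  by move: GA; rewrite (near_shift 0) subr0.
near=> h; rewrite [X in `|X|](_ : _ = 0).
  by rewrite normr0 mulr_ge0// ltW.
have Gw : G w = w *m A + b by exact: nbhs_singleton GA.
rewrite /= !fctE /= /shift Gw.
have -> : G (h + w) = (h + w) *m A + b by near: h.
by rewrite mulmxDl; apply/eqP; rewrite subr_eq0 -addrA addrC.
Unshelve. all: by end_near.
Qed.

End affine_maps.

Lemma near_open_simplex (R : realType) d (v : 'I_d.+1 -> 'rV[R]_d) x :
  open_simplex v x -> \forall y \near x, open_simplex v y.
Proof.
move=> x0; suff : \forall y \near x, forall i, 0 < bary v i y by [].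
apply: (@filter_forall _ _ (fun (i : 'I_d.+1) y => 0 < bary v i y) (nbhs x)
  (nbhs_filter x)) => i.
have [a [c ac]] := bary_affine v i.
have cb : bary v i @ x --> bary v i x.
  rewrite (_ : bary v i = (fun y : 'rV[R]_1 => y ord0 ord0) \o
      (fun x => x *m a + const_mx c)).
    apply: continuous_comp; first exact: continuous_affine.
    exact: coord_continuous.
  by apply/funext => y /=; rewrite ac [RHS]mxE [X in _ = _ + X]mxE.
exact: (cvgr_gt _ cb _ (x0 i)).
Qed.

(** * Convexity, measurability and supports *)

(** Each of a and b is a convex combination of 0 and a + b, so h(c) <= c / (a + b) h(a + b) for
    both; the two weights add up to 1. *)
Lemma convex_superadditive (R : realType) (h : R -> R) :
  convex_function (`[0, +oo[ : set R^o) h -> h 0 = 0 ->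
  forall a b, 0 <= a -> 0 <= b -> h a + h b <= h (a + b).
Proof.
move=> hconv h0 a b a0 b0.
have [ab0|ab0] := eqVneq (a + b) 0.
  have [-> ->] : a = 0 /\ b = 0 by split; lra.
  by rewrite addr0 h0 addr0.
have ab_gt0 : 0 < a + b by rewrite lt_neqAle eq_sym ab0 addr_ge0.
have key c : 0 <= c -> c <= a + b -> h c <= c / (a + b) * h (a + b).
  move=> c0 cab.
  have t0 : 0 <= c / (a + b) by rewrite divr_ge0// ltW.
  have t1 : c / (a + b) <= 1 by rewrite ler_pdivrMr// mul1r.
  have := hconv (Itv01 t0 t1) (a + b) 0.
  rewrite !inE /= !in_itv/= !andbT lexx (ltW ab_gt0) => /(_ isT isT).
  rewrite !convRE /= h0 !mulr0 !addr0 [X in h X](_ : _ = c) //.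
  transitivity (c / (a + b) * (a + b) + (1 - c / (a + b)) * 0); first by [].
  by rewrite mulr0 addr0 divfK.
have := lerD (key a a0 _) (key b b0 _).
rewrite -mulrDl -mulrDl divff// mul1r; apply; lra.
Qed.

Lemma convex_superadditive_sum (R : realType) (h : R -> R) :
  convex_function (`[0, +oo[ : set R^o) h -> h 0 = 0 ->
  forall (I : Type) (s : seq I) (c : I -> R), (forall i, 0 <= c i) ->
  \sum_(i <- s) h (c i) <= h (\sum_(i <- s) c i).
Proof.
move=> hconv h0 I s c c0; elim: s => [|i s IH]; first by rewrite !big_nil h0.
rewrite !big_cons; apply: le_trans (convex_superadditive hconv h0 _ _) => //.
  by rewrite lerD2l.
exact: sumr_ge0.
Qed.

Section separately_continuous.
Context (R : realType) (d : nat) (f : 'rV[R]_d -> R).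
Hypothesis fc : forall i x,
  f (t *: delta_mx ord0 i + x) @[t --> (0 : R)] --> f x.

Let mix k (c x : 'rV[R]_d) : 'rV[R]_d :=
  \row_i (if (i < k)%N then x ord0 i else c ord0 i).

Let set_coord (c : 'rV[R]_d) k a : 'rV[R]_d :=
  \row_i (if i == k then a else c ord0 i).

(* The coordinates are released one at a time: [f] at [x] is the limit of [f]
   with one coordinate of [x] rounded to a grid of mesh [1 / n.+1]. *)
Lemma measurable_separately_continuous : measurable_fun [set: 'rV[R]_d] f.
Proof.
suff H k c : measurable_fun [set: 'rV[R]_d] (f \o mix k c).
  rewrite (_ : f = f \o mix d 0); first exact: H.
  apply/funext => x /=; congr f; apply/rowP => i; by rewrite mxE ltn_ord.
elim: k c => [|k IH] c.
  rewrite (_ : f \o _ = cst (f c)); first exact: measurable_cst.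
  by apply/funext => x /=; congr f; apply/rowP => i; rewrite mxE.
have [kd|dk] := ltnP k d; last first.
  rewrite (_ : f \o _ = f \o mix k c); first exact: IH.
  apply/funext => x /=; congr f; apply/rowP => i; rewrite !mxE.
  by rewrite !(leq_trans (ltn_ord i)) ?(leq_trans dk).
pose i0 := Ordinal kd.
pose q n (z : int) : R := z%:~R / n.+1%:R.
pose fl n (x : 'rV[R]_d) := Num.floor (x ord0 i0 * n.+1%:R).
apply: (@measurable_fun_cvg _ _ _ _
    (fun n x => f (mix k (set_coord c i0 (q n (fl n x))) x))) => [n|x _].
  move=> _ B mB; rewrite setTI.
  (* The rounded coordinate takes countably many values, and on each level set the induction
     hypothesis applies with that value frozen. *)
  rewrite (_ : _ @^-1` B = \bigcup_z (fl n @^-1` [set z] `&`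
      (f \o mix k (set_coord c i0 (q n z))) @^-1` B)); last first.
    apply/seteqP; split => x /=; first by move=> Bx; exists (fl n x).
    by move=> [z _ [<-]].
  apply: countable_bigcupT_measurable; first exact: countableP.
  move=> z; apply: measurableI; last first.
    by rewrite -[X in measurable X]setTI; exact: IH.
  rewrite (_ : fl n @^-1` _ = (fun x : 'rV[R]_d => x ord0 i0 * n.+1%:R) @^-1`
      `[z%:~R, (z + 1)%:~R[).
    rewrite -[X in measurable X]setTI.
    apply: (@measurable_funM _ _ _ _ (fun x : 'rV[R]_d => x ord0 i0) (cst
      n.+1%:R)) => //.
    exact: measurable_rV_coord.
  apply/seteqP; split => x /=; rewrite in_itv/=.
    by move=> <-; rewrite /fl floor_le_tmp floorD1_gt.
  by move=> xz; exact: floor_def.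
(* Rounding displaces the point along a single axis by an error that tends to 0, so separate
   continuity suffices for the limit. *)
have E n : mix k (set_coord c i0 (q n (fl n x))) x =
    (q n (fl n x) - x ord0 i0) *: delta_mx ord0 i0 + mix k.+1 c x.
  apply/rowP => i; rewrite !mxE eqxx /= ltnS.
  have [->|ii0] := eqVneq i i0; first by rewrite ltnn leqnn mulr1 subrK.
  rewrite mulr0 add0r [in RHS]leq_eqVlt.
  by case: eqP => //= ik; case/eqP: ii0; apply/val_inj.
under eq_fun do rewrite E.
suff K : (fun n => q n (fl n x) - x ord0 i0) @ \oo --> (0 : R).
  exact: (cvg_comp _ _ K (@fc i0 (mix k.+1 c x))).
apply/cvgrPdist_le => e e0; near=> n.
rewrite sub0r normrN distrC /q.
have n0 : (0 : R) < n.+1%:R by [].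
rewrite ger0_norm; last first.
  by rewrite subr_ge0 ler_pdivrMr// floor_le_tmp.
have := floorD1_gt (x ord0 i0 * n.+1%:R); rewrite -/(fl n x) intrD => H.
have {H} : x ord0 i0 - (fl n x)%:~R / n.+1%:R <= n.+1%:R^-1.
  rewrite lerBlDr -(ler_pM2r n0) mulrDl divfK ?gt_eqF// mulVf ?gt_eqF// addrC.
  exact: ltW.
move/le_trans; apply; near: n.
by have := near_infty_natSinv_lt (PosNum e0); apply: filterS => n /ltW.
Unshelve. all: by end_near.
Qed.

End separately_continuous.

(** A partial derivative at a point yields continuity along that coordinate line, which is all that
    the previous lemma asks for. *)
Lemma C1_fun_measurable (R : realType) d (f : 'rV[R]_d -> R) :
  C1_fun f -> measurable_fun [set: 'rV[R]_d] f.
Proof.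
move=> f1; apply: measurable_separately_continuous => i x.
have [/(_ x)/derivable1P/derivable1_diffP/differentiable_continuous H _] := f1 i.
have E0 : f x = f (0 *: delta_mx ord0 i + x) by rewrite scale0r add0r.
by rewrite [X in _ --> X]E0; exact: H.
Qed.

(** A Lindeloef argument: every point off the support has an open neighbourhood without mass, which
    contains a massless box from a countable rational family around the point; on each such box
    [rho] vanishes almost everywhere. *)
Lemma integral_off_support (R : realType) d (rho : 'rV[R]_d -> R) :
  measurable_fun [set: 'rV[R]_d] rho -> (forall x, 0 <= rho x) ->
  (\int[lebesgue_rV R d]_(x in ~` support_density rho) (rho x)%:E = 0)%E.
Proof.
move=> mrho rho0.
pose box (p : 'rV[rat]_d * nat) : set 'rV[R]_d :=
  rV_box (fun i => `](ratr (p.1 ord0 i) - p.2.+1%:R^-1),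
                    (ratr (p.1 ord0 i) + p.2.+1%:R^-1)[%classic).
have mbox p : measurable (box p).
  by apply: measurable_rV_box => i; exact: measurable_itv.
pose null p := (\int[lebesgue_rV R d]_(y in box p) (rho y)%:E)%E = 0%E.
pose F k : set 'rV[R]_d := if unpickle k is Some p then
  [set y | null p /\ box p y /\ rho y != 0] else set0.
have FN k : (lebesgue_rV R d).-negligible (F k).
  rewrite /F; case: unpickle => [p|]; last exact: negligible_set0.
  have [np|np] := pselect (null p); last first.
    by apply: negligibleS (negligible_set0 _) => y [].
  have : (\int[lebesgue_rV R d]_(y in box p) `|(rho y)%:E| = 0)%E.
    by rewrite -[RHS]np; apply: eq_integral => y _; rewrite gee0_abs// lee_fin.
  move=> /ae_eq_integral_abs [//||N [mN N0 sN]].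
    by apply/measurable_EFinP; exact: measurable_funTS.
  exists N; split=> // y [_ [By /eqP ry]]; apply: sN => /= H.
  by apply: ry; have [] := H By.
have [N [mN N0 sN]] := negligible_bigcup FN.
rewrite (@eq_integral_off_null _ _ _ _ _ N _ (cst 0%E)) ?integral0// => x Kx Nx.
apply/eqP; rewrite eqe; apply: contrapT => /negP rx; apply: Nx; apply: sN.
have [U [oU [Ux U0]]] : exists U, open U /\ U x /\
    ~ (0 < \int[lebesgue_rV R d]_(y in U) (rho y)%:E)%E.
  apply: contrapT => nU; apply: Kx => U oU Ux; apply: contrapT => H.
  by apply: nU; exists U.
have /nbhs_ballP[e /= e0 eU] := open_nbhs_nbhs (conj oU Ux).
(* Half of the radius is spent on the distance from [x] to the rational centre, the other half on
   the half-width of the box. *)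
have [n ne] : exists n, n.+1%:R^-1 < e / 2.
  have e20 : 0 < e / 2 by rewrite divr_gt0.
  have [n _ Hn] := near_infty_natSinv_lt (PosNum e20).
  by exists n; exact: (Hn n (leqnn n)).
have [q qx] : exists q : 'I_d -> rat, forall i,
    ratr (q i) \in `](x ord0 i - n.+1%:R^-1), (x ord0 i + n.+1%:R^-1)[.
  apply: (@fin_all_exists 'I_d (fun=> rat) (fun i q => ratr q \in
    `](x ord0 i - n.+1%:R^-1), (x ord0 i + n.+1%:R^-1)[)) => i.
  apply: rat_in_itvoo.
  by rewrite ltrBlDr -addrA ltrDl addr_gt0 ?invr_gt0.
pose p := ((\row_i q i, n) : 'rV[rat]_d * nat).
have boxU : box p `<=` U.
  move=> y By; apply: eU; split => // i0 i; have -> : i0 = ord0 by rewrite ord1.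
  have := By i; have := qx i; rewrite /p /= !in_itv/= mxE.
  move=> /andP[xq qx'] /andP[qy yq].
  have aux (a b u w c : R) : a < c / 2 -> u - a < b -> b < u + a ->
      b - a < w -> w < b + a -> `|u - w| < c.
    by move=> ? ? ? ? ?; rewrite ltr_norml; apply/andP; split; lra.
  exact: (aux _ _ _ _ _ ne xq qx' qy yq).
exists (pickle p) => //; rewrite /F pickleK; split; last first.
  split=> // i; have := qx i; rewrite /p /= !in_itv/= mxE => /andP[xq qx'].
  by rewrite ltrBlDr qx' -ltrBlDr xq.
apply/eqP; rewrite eq_le integral_ge0 ?andbT; last first.
  by move=> y _; rewrite lee_fin.
rewrite leNgt; apply/negP => pos; apply: U0; apply: (lt_le_trans pos).
rewrite integral_mkcond [leRHS]integral_mkcond.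
apply: ge0_le_integral_gen => y _; rewrite /patch.
  by case: ifP => // _; rewrite lee_fin.
case: ifPn => [/set_mem/boxU Uy|_]; first by rewrite mem_set.
by case: ifP => // _; rewrite lee_fin.
Qed.

(** * Integrals over a simplicial decomposition *)

Section decomposition.
Context (R : realType) (d M : nat) (d_gt0 : (0 < d)%N).
Variables (K : set 'rV[R]_d) (T : 'I_M -> 'I_d.+1 -> 'rV[R]_d).
Hypothesis T_decomp : simplicial_decomposition K T.
Local Notation leb := (lebesgue_rV R d).

Let Tfree m : affinely_independent (T m).
Proof. by have [H _ _ _] := T_decomp; exact: H. Qed.

Lemma simplex_sub m : simplex (T m) `<=` K.
Proof. by have [_ -> _ _] := T_decomp => x Sx; exists m. Qed.

Lemma decomposition_cover x : K x -> exists m, simplex (T m) x.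
Proof. by have [_ -> _ _] := T_decomp => -[m _ Sx]; exists m. Qed.

Lemma measurable_piece m : measurable (simplex (T m)).
Proof. exact: measurable_simplex. Qed.

Lemma bigsetU_ordP n (F : 'I_n -> set 'rV[R]_d) x :
  (\big[setU/set0]_(i < n) F i) x <-> exists i, F i x.
Proof.
rewrite -bigcup_seq; split=> [[i _ Fx]|[i Fx]]; exists i => //=.
by rewrite mem_index_enum.
Qed.

Lemma measurable_decomposition : measurable K.
Proof.
rewrite (_ : K = \big[setU/set0]_(m < M) simplex (T m)).
  by apply: bigsetU_measurable => m _; exact: measurable_piece.
apply/seteqP; split => x.
  by move=> /decomposition_cover Sx; apply/bigsetU_ordP.
by move=> /bigsetU_ordP[m]; exact: simplex_sub.
Qed.

Definition skeleton : set 'rV[R]_d :=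
  \big[setU/set0]_(m < M) (simplex (T m) `\` open_simplex (T m)).

Lemma measurable_skeleton : measurable skeleton.
Proof.
apply: bigsetU_measurable => m _; apply: measurableD.
  exact: measurable_piece.
exact: measurable_open_simplex.
Qed.

Lemma skeleton_null : leb skeleton = 0%E.
Proof.
apply: bigsetU_null => m; last exact: simplex_boundary_null.
by apply: measurableD; [exact: measurable_piece|exact: measurable_open_simplex].
Qed.

Lemma off_skeleton m x : simplex (T m) x -> ~ skeleton x -> open_simplex (T m) x.
Proof.
move=> Sx nx; apply: contrapT => ox; apply: nx; apply/bigsetU_ordP.
by exists m.
Qed.

(* A common face of two distinct simplices is a proper face of one of them. *)
Lemma off_skeleton_unique m m' x : simplex (T m) x -> simplex (T m') x ->
  ~ skeleton x -> m' = m.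
Proof.
move=> Sx Sx' nx; have [_ _ Tinj /(_ m m')[I [I' [EI EI']]]] := T_decomp.
have full J k : simplex (T k) x -> face (T k) J x -> J = finset.setT.
  move=> Sk Fk; apply/finset.setP => i; rewrite finset.inE;
    apply: contrapT => /negP iJ.
  have /(_ i) := off_skeleton Sk nx.
  by rewrite (bary_face (Tfree k) Fk iJ) ltxx.
have Ifull : I = finset.setT by apply: (full _ m) => //; rewrite -EI; split.
have Ifull' : I' = finset.setT by apply: (full _ m') => //; rewrite -EI'; split.
have Em : simplex (T m) = face (T m) I by rewrite Ifull.
have Em' : simplex (T m') = face (T m') I' by rewrite Ifull'.
by apply/esym/Tinj; rewrite /= Em Em' -EI -EI'.
Qed.

Lemma sum_patch_unique (V : nmodType) (D : 'I_M -> set 'rV[R]_d)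
    (f : 'I_M -> 'rV[R]_d -> V) m x :
  D m x -> (forall m', D m' x -> m' = m) ->
  \sum_i patch (fun=> 0) (D i) (f i) x = f m x.
Proof.
move=> Dx Dm; rewrite (bigD1 m)//= big1 ?addr0.
  by rewrite /patch mem_set.
move=> i im; rewrite /patch; case: ifPn => // /set_mem /Dm iE.
by rewrite iE eqxx in im.
Qed.

(** Only the local formulas [phi_] are measurable; [phi] has to match them inside the open
    simplices, which is what makes integrands with ['J G] or [discrete_density] tractable. *)
Lemma integral_decomposition (phi : 'rV[R]_d -> \bar R)
    (phi_ : 'I_M -> 'rV[R]_d -> \bar R) :
  (forall m, measurable_fun [set: 'rV[R]_d] (phi_ m)) ->
  (forall m x, (0 <= phi_ m x)%E) ->
  (forall m x, open_simplex (T m) x -> ~ skeleton x -> phi x = phi_ m x) ->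
  (\int[leb]_(x in K) phi x = \sum_m \int[leb]_(x in simplex (T m)) phi_ m x)%E.
Proof.
move=> mphi phi0 phiE; rewrite integral_mkcond.
rewrite -(ge0_integral_sum_patch leb measurable_piece)//; last first.
  by move=> m; apply: measurable_funTS.
apply: (eq_integral_off_null measurable_skeleton skeleton_null) => x _ nx.
rewrite {1}/patch; case: ifPn => [/set_mem/decomposition_cover[m Sx]|Kx].
  rewrite (@sum_patch_unique _ (fun k => simplex (T k)) phi_ m x Sx); last first.
    by move=> m' Sx'; exact: off_skeleton_unique Sx Sx' nx.
  by rewrite (phiE m)//; exact: off_skeleton.
rewrite big1// => m _; rewrite /patch; case: ifPn => // /set_mem /simplex_sub Kx'.
by rewrite mem_set in Kx.
Qed.

Lemma lebesgue_simplex_fin m : (leb (simplex (T m)) < +oo)%E.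
Proof.
(* [B] dominates every coordinate of every vertex combination with weights between 0 and 1 and total
   1. *)
pose B := \sum_k \sum_(i < d) `|T m k ord0 i|.
pose box : set 'rV[R]_d := rV_box (fun _ => `[- B, B]%classic).
have mbox : measurable box by apply: measurable_rV_box => i;
  exact: measurable_itv.
apply: (@le_lt_trans _ _ (leb box)).
  apply: le_measure; rewrite ?inE//; first exact: measurable_piece.
  move=> x [w [w0 _ w1 ->]] i /=; rewrite in_itv/= -ler_norml.
  have -> : (\sum_k w k *: T m k) ord0 i = \sum_k w k * T m k ord0 i.
    by rewrite summxE; apply: eq_bigr => k _; rewrite mxE.
  apply: (le_trans (ler_norm_sum _ _ _)).
  apply: ler_sum => k _; rewrite normrM.
  have wk : `|w k| <= 1.
    by rewrite ger0_norm// -w1 (bigD1 k)//= lerDl sumr_ge0.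
  apply: le_trans (ler_piMl _ wk) _ => //.
  by rewrite (bigD1 i)//= lerDl sumr_ge0.
rewrite lebesgue_rV_box; last by move=> i; exact: measurable_itv.
rewrite (eq_bigr (fun=> (B + B)%:E)) => [|i _]; last first.
  have B0 : 0 <= B by apply: sumr_ge0 => k _; apply: sumr_ge0.
  rewrite lebesgue_measure_itv/= lte_fin -EFinB opprK.
  case: ifPn => //; rewrite -leNgt => BB; congr EFin; lra.
by rewrite prodEFin ltry.
Qed.

Section discrete.
Variable rhobar : 'rV[R]_d -> R.
Hypotheses (rhobar_P2ac : P2ac rhobar) (K_supp : K = support_density rhobar).

Definition cell_density m : R :=
  fine (\int[leb]_(y in simplex (T m)) (rhobar y)%:E)%E / fine (leb (simplex
    (T m))).

Lemma cell_density_ge0 m : 0 <= cell_density m.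
Proof.
have [_ rho0 _ _] := rhobar_P2ac.
by rewrite divr_ge0// fine_ge0// integral_ge0// => x _; rewrite lee_fin.
Qed.

Lemma discrete_densityE m x : simplex (T m) x -> ~ skeleton x ->
  discrete_density T rhobar x = cell_density m.
Proof.
move=> Sx nx; rewrite /discrete_density; case: pickP => [m' /set_mem Sx'|/(_ m)].
  by rewrite (off_skeleton_unique Sx Sx' nx).
by rewrite mem_set.
Qed.

Lemma cell_density_mass m : ((cell_density m)%:E * leb (simplex (T m)) =
  \int[leb]_(y in simplex (T m)) (rhobar y)%:E)%E.
Proof.
have [mrho rho0 rho1 _] := rhobar_P2ac.
have fS : leb (simplex (T m)) \is a fin_num.
  by rewrite ge0_fin_numE// lebesgue_simplex_fin.
have fI : (\int[leb]_(y in simplex (T m)) (rhobar y)%:E)%E \is a fin_num.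
  rewrite ge0_fin_numE; last by apply: integral_ge0 => x _; rewrite lee_fin.
  apply: (@le_lt_trans _ _ 1%E); last by rewrite ltry.
  rewrite -rho1 integral_mkcond; apply: ge0_le_integral_gen => x _;
    rewrite /patch;
    by case: ifP => //; rewrite lee_fin.
(* The quotient in [cell_density] cancels only for non-zero volume; for zero volume both sides
   vanish. *)
have [S0|S0] := eqVneq (fine (leb (simplex (T m)))) 0.
  have S0' : leb (simplex (T m)) = 0%E by rewrite -(fineK fS) S0.
  rewrite S0' mule0 (eq_integral_off_null (measurable_piece m) S0' (g := cst
    0%E)).
    by rewrite integral0.
  by [].
by rewrite -{1}(fineK fS) -EFinM /cell_density divfK// fineK.
Qed.

(** Averaging preserves the mass of each simplex, and [rhobar] has no mass outside its support K.
    This makes the couplings below probabilities and the induced densities integrable. *)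
Lemma sum_cell_mass : (\sum_m (cell_density m)%:E * leb (simplex (T m)) = 1)%E.
Proof.
have [mrho rho0 rho1 _] := rhobar_P2ac.
under eq_bigr do rewrite cell_density_mass.
have mr : measurable_fun [set: 'rV[R]_d] (EFin \o rhobar).
  exact/measurable_EFinP.
have r0 x : (0 <= (EFin \o rhobar) x)%E by rewrite lee_fin.
rewrite -(@integral_decomposition (EFin \o rhobar) (fun=> EFin \o rhobar)
  (fun=> mr) (fun=> r0))//.
have mK := measurable_decomposition.
rewrite -rho1 -[in RHS](setUv K) ge0_integral_setU//=; last 4 first.
- exact: measurableC.
- by rewrite setUv; exact/measurable_EFinP.
- by move=> x _; rewrite lee_fin.
- by rewrite disj_set2E setICr.
rewrite [X in (_ + X)%E](_ : _ = 0%E) ?adde0//.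
by rewrite K_supp; exact: integral_off_support.
Qed.

End discrete.

End decomposition.

(** * Densities and entropies of piecewise affine maps *)

Section affine_piece.
Context (R : realType) (d : nat) (A : 'M[R]_d) (b : 'rV[R]_d).
Hypothesis detA : 0 < \det A.
Local Notation leb := (lebesgue_rV R d).

Definition aff (x : 'rV[R]_d) : 'rV[R]_d := x *m A + b.

Definition aff_inv (x : 'rV[R]_d) : 'rV[R]_d :=
  x *m invmx A + (- (b *m invmx A)).

Let Au : A \in unitmx.
Proof. by rewrite unitmxE unitfE gt_eqF. Qed.

Lemma affK : cancel aff aff_inv.
Proof. by move=> x; rewrite /aff /aff_inv mulmxDl mulmxK// addrK. Qed.

Lemma aff_invK : cancel aff_inv aff.
Proof.
by move=> x; rewrite /aff /aff_inv mulmxDl mulmxKV// mulNmx mulmxKV// subrK.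
Qed.

Lemma measurable_aff : measurable_fun [set: 'rV[R]_d] aff.
Proof. exact: measurable_affine. Qed.

Lemma measurable_aff_inv : measurable_fun [set: 'rV[R]_d] aff_inv.
Proof. exact: measurable_affine. Qed.

Lemma lebesgue_preimage_aff E : measurable E ->
  leb (aff @^-1` E) = ((\det A)^-1%:E * leb E)%E.
Proof.
by move=> mE; rewrite scales_lebesgueT// ?gt_eqF// gtr0_norm.
Qed.

Lemma lebesgue_preimage_aff_inv_null E : measurable E -> leb E = 0%E ->
  leb (aff_inv @^-1` E) = 0%E.
Proof.
move=> mE E0; rewrite scales_lebesgueT ?E0 ?mule0//.
by rewrite det_inv invr_eq0 gt_eqF.
Qed.

Lemma integral_image_aff (S : set 'rV[R]_d) (psi : 'rV[R]_d -> \bar R) :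
  measurable S -> measurable_fun [set: 'rV[R]_d] psi ->
  (forall x, 0 <= psi x)%E ->
  (\int[leb]_(x in aff_inv @^-1` S) psi x =
   (\det A)%:E * \int[leb]_(w in S) psi (aff w))%E.
Proof.
move=> mS mpsi psi0; have k0 : 0 <= (\det A)^-1 by rewrite invr_ge0 ltW.
have mQ : measurable (aff_inv @^-1` S) by exact: measurable_preimage_affine.
have := @ge0_integral_scaling _ _ _ _ R leb leb aff (NngNum k0) measurable_aff
  lebesgue_preimage_aff (aff_inv @^-1` S) psi mQ (measurable_funTS mpsi)
  (fun y _ => psi0 y).
rewrite (_ : aff @^-1` _ = S); last first.
  by apply/seteqP; split => x /=; rewrite affK.
by move=> ->; rewrite /= muleA -EFinM divff ?mul1e// gt_eqF.
Qed.

End affine_piece.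

Lemma sqnorm_ge0 (R : realType) d (x : 'rV[R]_d) : 0 <= sqnorm x.
Proof. by apply: sumr_ge0 => i _; exact: sqr_ge0. Qed.

Lemma sqnormZ (R : realType) d a (x : 'rV[R]_d) : sqnorm (a *: x) = a ^+ 2 *
  sqnorm x.
Proof. by rewrite /sqnorm mulr_sumr; apply: eq_bigr => i _;
  rewrite mxE exprMn. Qed.

Lemma measurable_sqnorm_sub (R : realType) d1 (X : measurableType d1) d
    (f g : X -> 'rV[R]_d) :
  measurable_fun [set: X] f -> measurable_fun [set: X] g ->
  measurable_fun [set: X] (fun x => sqnorm (f x - g x)).
Proof.
move=> mf mg; rewrite /sqnorm; apply: measurable_sum => i; apply: measurable_funX.
rewrite (_ : (fun _ => _) = (fun x => f x ord0 i - g x ord0 i)); last first.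
  by apply/funext => x; rewrite !mxE.
by apply: measurable_funB;
  apply: (@measurableT_comp _ _ _ _ _ _ (fun y : 'rV[R]_d => y ord0 i)) => //;
  exact: measurable_rV_coord.
Qed.

Section piecewise_affine.
Context (R : realType) (d M : nat) (d_gt0 : (0 < d)%N).
Variables (K : set 'rV[R]_d) (T : 'I_M -> 'I_d.+1 -> 'rV[R]_d).
Hypothesis T_decomp : simplicial_decomposition K T.
Variable rhobar : 'rV[R]_d -> R.
Hypotheses (rhobar_P2ac : P2ac rhobar) (K_supp : K = support_density rhobar).
Local Notation leb := (lebesgue_rV R d).
Local Notation r := (cell_density T rhobar).
Local Notation rhoT := (discrete_density T rhobar).
Local Notation S m := (simplex (T m)).

Definition pieces (G : 'rV[R]_d -> 'rV[R]_d) (A : 'I_M -> 'M[R]_d) (b : 'I_M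
  -> 'rV[R]_d) :=
  (forall m, 0 < \det (A m)) /\
  forall m w, S m w -> G w = aff (A m) (b m) w.

Lemma admissible_pieces G : admissible_map K T G -> exists A b, pieces G A b.
Proof.
move=> [_ H].
have /fin_all_exists[A /fin_all_exists[b Ab]] : forall m, exists A b,
    0 < \det A /\ forall w, S m w -> G w = aff A b w by exact: H.
by exists A, b; split=> [m|m w]; have [? Gw] := Ab m => //; exact: Gw.
Qed.

Section one_map.
Variables (G : 'rV[R]_d -> 'rV[R]_d) (A : 'I_M -> 'M[R]_d) (b : 'I_M -> 'rV[R]_d).
Hypothesis GAb : pieces G A b.
Variable rho : 'rV[R]_d -> R.
Hypothesis rho_push : pushforward_density K G rhoT rho.

Let detA m : 0 < \det (A m). Proof. by case: GAb. Qed.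

Let Gaff m w : S m w -> G w = aff (A m) (b m) w. Proof. by case: GAb => _;
  exact. Qed.

Let r_ge0 m : 0 <= r m. Proof. exact: cell_density_ge0. Qed.

Let mS m : measurable (S m). Proof. exact: (measurable_piece T_decomp). Qed.

(** The image of the simplex under its affine map, written as a preimage so that measurability is
    immediate. *)
Definition cell_image m : set 'rV[R]_d := aff_inv (A m) (b m) @^-1` S m.

Let mQ m : measurable (cell_image m).
Proof. exact: measurable_preimage_affine. Qed.

Definition image_density m := r m / \det (A m).

Let c_ge0 m : 0 <= image_density m.
Proof. by rewrite divr_ge0// ltW. Qed.

Let preimage_cell_image m : aff (A m) (b m) @^-1` cell_image m = S m.
Proof. by apply/seteqP; split => x; rewrite /cell_image /= affK. Qed.

(** Used twice: to identify the induced density almost everywhere, and to recognize the marginals of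
    the coupling. *)
Lemma pushforward_mass E : measurable E ->
  (\int[leb]_(x in E) (rho x)%:E =
   \sum_m (r m)%:E * leb (aff (A m) (b m) @^-1` E `&` S m))%E.
Proof.
move=> mE; have [_ _ ->//] := rho_push.
have mpre m : measurable (aff (A m) (b m) @^-1` E) by exact:
  measurable_preimage_affine.
rewrite integral_mkcondr.
rewrite (@integral_decomposition _ _ _ d_gt0 _ _ T_decomp _
  (fun m x => ((r m)%:E * (\1_(aff (A m) (b m) @^-1` E) x)%:E)%E)).
- apply: eq_bigr => m _; rewrite ge0_integralZl_EFin//.
  + by rewrite integral_indic.
  + by apply/measurable_EFinP; exact: measurable_indic.
- move=> m; apply/measurable_EFinP; apply: measurable_funM => //;
    exact: measurable_indic.
- by move=> m x; rewrite -EFinM lee_fin mulr_ge0.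
- move=> m x /open_simplex_sub Sx nx.
  have {}Sx : S m x by apply: Sx; have [] := T_decomp.
  rewrite /patch indicE.
  have -> : (x \in G @^-1` E) = (x \in aff (A m) (b m) @^-1` E).
    by apply/idP/idP => /set_mem /= H; apply/mem_set;
      rewrite /= ?(Gaff Sx)// -(Gaff Sx).
  case: ifP => _; last by rewrite mule0.
  by rewrite mule1 (@discrete_densityE _ _ _ _ _ T_decomp _ m).
Qed.

(** Both sides have the same integral over every measurable set, and [rho] is integrable with mass
    1, so they agree almost everywhere. Where images overlap the constants add up. *)
Lemma pushforward_densityE : exists N, [/\ measurable N, leb N = 0%E &
  forall x, ~ N x -> rho x = \sum_m image_density m * \1_(cell_image m) x].
Proof.
have [mrho rho0 _] := rho_push.
pose g x := \sum_m image_density m * \1_(cell_image m) x.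
have mg : measurable_fun [set: 'rV[R]_d] g.
  apply: measurable_sum => m; apply: measurable_funM => //;
    exact: measurable_indic.
have fg E : measurable E ->
    (\int[leb]_(x in E) (rho x)%:E = \int[leb]_(x in E) (g x)%:E)%E.
  move=> mE; rewrite pushforward_mass//.
  under [RHS]eq_integral do rewrite -sumEFin.
  rewrite ge0_integral_sum//; last 2 first.
  - move=> m; apply/measurable_EFinP; apply: measurable_funM => //;
      exact: measurable_indic.
  - by move=> m x _; rewrite lee_fin mulr_ge0.
  apply: eq_bigr => m _.
  under [RHS]eq_integral do rewrite EFinM.
  rewrite ge0_integralZl_EFin//; last first.
    by apply/measurable_EFinP; exact: measurable_indic.
  rewrite integral_indic// /image_density [in RHS]EFinM -muleA.
  rewrite -(lebesgue_preimage_aff (b m))//; last exact: measurableI.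
  by rewrite preimage_setI preimage_cell_image setIC.
have irho : leb.-integrable [set: 'rV[R]_d] (EFin \o rho).
  apply/integrableP; split; first exact/measurable_EFinP.
  under eq_integral do rewrite /= ger0_norm//.
  rewrite pushforward_mass//.
  under eq_bigr do rewrite preimage_setT setTI.
  by rewrite (sum_cell_mass d_gt0 T_decomp)// ltry.
have [|N [mN N0 sN]] := integral_ae_eq measurableT (g := EFin \o g) irho _
  (fun E _ => @fg E).
  exact/measurable_EFinP.
exists N; split => // x Nx; apply: contrapT => H; apply: Nx;
  apply: sN => /= /(_ Logic.I).
by move=> [].
Qed.

Lemma integral_cell_images (psi : 'I_M -> 'rV[R]_d -> \bar R) :
  (forall m, measurable_fun [set: 'rV[R]_d] (psi m)) ->
  (forall m x, 0 <= psi m x)%E ->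
  (\int[leb]_x (\sum_m (psi m \_ (cell_image m)) x) =
   \sum_m (\det (A m))%:E * \int[leb]_(w in S m) psi m (aff (A m) (b m) w))%E.
Proof.
move=> mpsi psi0; rewrite ge0_integral_sum_patch//.
  by apply: eq_bigr => m _; rewrite integral_image_aff.
by move=> m; exact: measurable_funTS.
Qed.

Lemma cell_image_sub m x : cell_image m x ->
  S m (aff_inv (A m) (b m) x) /\ G (aff_inv (A m) (b m) x) = x.
Proof. by move=> Qx; split => //; rewrite (Gaff Qx) aff_invK. Qed.

(** By injectivity a point of two images has one common preimage, which lies in two simplices and
    hence in the skeleton. The exceptional set collects the affine images of the skeleton. *)
Lemma cell_images_overlap : set_inj K G ->
  exists N, [/\ measurable N, leb N = 0%E & forall x m m', ~ N x ->
    cell_image m x -> cell_image m' x -> m' = m].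
Proof.
move=> Ginj.
have msk := measurable_skeleton T_decomp.
exists (\big[setU/set0]_(m < M) (aff_inv (A m) (b m) @^-1` skeleton T)); split.
- by apply: bigsetU_measurable => m _; exact: measurable_preimage_affine.
- apply: bigsetU_null => m; first exact: measurable_preimage_affine.
  by apply: lebesgue_preimage_aff_inv_null => //;
    exact: (skeleton_null d_gt0 T_decomp).
- move=> x m m' Nx /cell_image_sub[Sx Gx] /cell_image_sub[Sx' Gx'].
  have E : aff_inv (A m') (b m') x = aff_inv (A m) (b m) x.
    have Kx := simplex_sub T_decomp Sx; have Kx' := simplex_sub T_decomp Sx'.
    by apply: Ginj; rewrite ?inE// Gx Gx'.
  apply: (off_skeleton_unique T_decomp Sx); first by rewrite -E.
  by move=> sk; apply: Nx; apply/bigsetU_ordP; exists m.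
Qed.

Section entropies.
Variables (h : R -> R) (V : 'rV[R]_d -> R).
Hypotheses (h_ge0 : forall s, 0 <= s -> 0 <= h s) (h0 : h 0 = 0).
Hypothesis h_convex : convex_function (`[0, +oo[ : set R^o) h.
Hypotheses (V_ge0 : forall x, 0 <= V x) (mV : measurable_fun [set: 'rV[R]_d] V).

Let psi m x := (h (image_density m) + V x * image_density m)%:E.

Let psi_ge0 m x : (0 <= psi m x)%E.
Proof. by rewrite lee_fin addr_ge0 ?h_ge0// mulr_ge0. Qed.

Let mpsi m : measurable_fun [set: 'rV[R]_d] (psi m).
Proof. by apply/measurable_EFinP; apply: measurable_funD => //;
  exact: measurable_funM. Qed.

Lemma transformed_entropyE : transformed_entropy h V K rhoT G =
  (\int[leb]_x (\sum_m (psi m \_ (cell_image m)) x))%E.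
Proof.
have mpsi_aff m : measurable_fun [set: 'rV[R]_d]
    (fun w => psi m (aff (A m) (b m) w)).
  apply: (@measurableT_comp _ _ _ _ _ _ (psi m)) => //; exact: measurable_aff.
rewrite integral_cell_images//.
rewrite /transformed_entropy (@integral_decomposition _ _ _ d_gt0 _ _ T_decomp _
  (fun m w => ((\det (A m))%:E * psi m (aff (A m) (b m) w))%E)).
- apply: eq_bigr => m _; rewrite ge0_integralZl_EFin//; last exact/ltW.
  exact: measurable_funTS (mpsi_aff m).
- by move=> m; apply: measurable_funeM; exact: mpsi_aff.
- by move=> m x; rewrite mule_ge0// lee_fin ltW.
- move=> m x ox nx; have Sx : S m x.
    by apply: open_simplex_sub => //; have [] := T_decomp.
  rewrite (@discrete_densityE _ _ _ _ _ T_decomp _ m)//.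
  have -> : 'J G x = A m.
    apply: (@jacobian_near_affine _ _ _ (b m)).
    have := near_open_simplex ox; apply: filterS => y oy.
    by apply: Gaff; apply: open_simplex_sub => //; have [] := T_decomp.
  rewrite (Gaff Sx) -EFinM; congr EFin;
    rewrite /htilde (invf_div (\det (A m)) (r m)).
  rewrite /image_density.
  (* On an empty cell the argument of [htilde] is a division by zero, but its weight is 0 and
     [h 0 = 0] on the other side. Otherwise r htilde(det A / r) = det A h(r / det A). *)
  have [->|r0] := eqVneq (r m) 0; first by rewrite !(mul0r, mulr0) h0 addr0 mulr0.
  by field; rewrite r0 gt_eqF.
Qed.

Lemma entropy_ge0 : (0 <= entropy h V rho)%E.
Proof.
have [_ rho0 _] := rho_push.
by apply: integral_ge0 => x _; rewrite lee_fin addr_ge0 ?h_ge0// mulr_ge0.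
Qed.

Lemma le_entropy : (transformed_entropy h V K rhoT G <= entropy h V rho)%E.
Proof.
rewrite transformed_entropyE; have [N [mN N0 rhoE]] := pushforward_densityE.
have [_ rho0 _] := rho_push.
apply: (ge0_le_integral_off_null mN N0) => x _.
- by apply: sume_ge0 => m _; rewrite /patch; case: ifP.
- by rewrite lee_fin addr_ge0 ?h_ge0// mulr_ge0.
- move=> Nx; rewrite rhoE//.
  rewrite (eq_bigr (fun m => (h (image_density m * \1_(cell_image m) x) +
    V x * (image_density m * \1_(cell_image m) x))%:E)) => [|m _].
    rewrite sumEFin lee_fin big_split/= -mulr_sumr lerD2r.
    by apply: convex_superadditive_sum => // m; rewrite mulr_ge0.
  by rewrite /patch indicE; case: ifP => _; rewrite ?mulr1 ?mulr0 ?h0 ?addr0.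
Qed.

Lemma entropyE : set_inj K G -> entropy h V rho = transformed_entropy h V K
  rhoT G.
Proof.
move=> /cell_images_overlap[N' [mN' N0' Nuniq]].
rewrite transformed_entropyE; have [N [mN N0 rhoE]] := pushforward_densityE.
have mNN := measurableU N N' mN mN'.
apply: (eq_integral_off_null mNN (null_set_setU mN mN' N0 N0')) => x _ NNx.
have Nx : ~ N x by move=> ?; apply: NNx; left.
have Nx' : ~ N' x by move=> ?; apply: NNx; right.
rewrite rhoE//.
have [[m Qx]|nQ] := pselect (exists m, cell_image m x).
  rewrite (@sum_patch_unique _ _ _ _ cell_image psi m x Qx) => [|m' Qx'];
    last first.
    exact: Nuniq Nx' Qx Qx'.
  rewrite (bigD1 m)//= big1 => [|i im]; last first.
    rewrite indicE memNset ?mulr0// => Qi.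
    by rewrite (Nuniq _ _ _ Nx' Qx Qi) eqxx in im.
  by rewrite addr0 indicE mem_set// mulr1.
have nQm m : x \in cell_image m = false by apply/negP => /set_mem Qx;
  apply: nQ; exists m.
rewrite big1 => [|m _]; last by rewrite indicE nQm mulr0.
by rewrite h0 mulr0 addr0 big1// => m _; rewrite /patch nQm.
Qed.

End entropies.

End one_map.

End piecewise_affine.

(** * Couplings and velocities *)

Section probability_of_measure.
Context dT (X : measurableType dT) (R : realType) (m : {measure set X -> \bar R}).
Hypothesis m1 : m setT = 1%E.
(** [W2] takes an infimum over [probability], whereas the coupling is built as a sum of measures;
    the alias carries the stronger structure. *)
Definition as_probability : set X -> \bar R := m.
HB.instance Definition _ := Measure.on as_probability.
HB.instance Definition _ := Measure_isProbability.Build _ _ _ as_probability m1.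
Definition to_probability : probability X R := as_probability.
End probability_of_measure.

Lemma measure_is_probability dT (X : measurableType dT) (R : realType)
    (m : {measure set X -> \bar R}) : m setT = 1%E ->
  exists P : probability X R, P = m :> (set X -> \bar R).
Proof. by move=> m1; exists (to_probability m1). Qed.

Section couplings.
Context (R : realType) (d M : nat) (d_gt0 : (0 < d)%N).
Variables (K : set 'rV[R]_d) (T : 'I_M -> 'I_d.+1 -> 'rV[R]_d).
Hypothesis T_decomp : simplicial_decomposition K T.
Variable rhobar : 'rV[R]_d -> R.
Hypotheses (rhobar_P2ac : P2ac rhobar) (K_supp : K = support_density rhobar).
Local Notation leb := (lebesgue_rV R d).
Local Notation r := (cell_density T rhobar).
Local Notation rhoT := (discrete_density T rhobar).
Local Notation S m := (simplex (T m)).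

Definition sqdist (G1 G2 : 'rV[R]_d -> 'rV[R]_d) : \bar R :=
  (\int[leb]_(w in K) (sqnorm (G1 w - G2 w) * rhoT w)%:E)%E.

Let r_ge0 m : 0 <= r m. Proof. exact: cell_density_ge0. Qed.

Let mS m : measurable (S m). Proof. exact: (measurable_piece T_decomp). Qed.

Let open_sub m x : open_simplex (T m) x -> S m x.
Proof. by apply: open_simplex_sub; have [] := T_decomp. Qed.

Lemma discrete_density_ge0 w : 0 <= rhoT w.
Proof. by rewrite /discrete_density; case: pickP => // m _; exact: r_ge0. Qed.

Lemma sqdist_ge0 G1 G2 : (0 <= sqdist G1 G2)%E.
Proof.
apply: integral_ge0 => w _.
by rewrite lee_fin mulr_ge0 ?sqnorm_ge0 ?discrete_density_ge0.
Qed.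

Lemma sqdist_self G : sqdist G G = 0%E.
Proof.
apply: integral0_eq => w _; rewrite subrr (_ : sqnorm 0 = 0) ?mul0r//.
by rewrite /sqnorm big1// => i _; rewrite mxE expr0n.
Qed.

Section two_maps.
Variables (G1 G2 : 'rV[R]_d -> 'rV[R]_d).
Variables (A1 A2 : 'I_M -> 'M[R]_d) (b1 b2 : 'I_M -> 'rV[R]_d).
Hypotheses (G1p : pieces T G1 A1 b1) (G2p : pieces T G2 A2 b2).

Let dist_ m w := sqnorm (aff (A1 m) (b1 m) w - aff (A2 m) (b2 m) w).

Let mdist m : measurable_fun [set: 'rV[R]_d] (dist_ m).
Proof. by apply: measurable_sqnorm_sub; exact: measurable_aff. Qed.

Lemma sqdistE : (sqdist G1 G2 =
  \sum_m (r m)%:E * \int[leb]_(w in S m) (dist_ m w)%:E)%E.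
Proof.
rewrite /sqdist (@integral_decomposition _ _ _ d_gt0 _ _ T_decomp _
  (fun m w => ((r m)%:E * (dist_ m w)%:E)%E)).
- apply: eq_bigr => m _; rewrite ge0_integralZl_EFin//.
  + by move=> x _; rewrite lee_fin sqnorm_ge0.
  + by apply/measurable_EFinP; exact: measurable_funTS.
- by move=> m; apply/measurable_EFinP; exact: measurable_funM.
- by move=> m x; rewrite -EFinM lee_fin mulr_ge0 ?sqnorm_ge0.
- move=> m x ox nx; have Sx := open_sub ox.
  rewrite (@discrete_densityE _ _ _ _ _ T_decomp _ m)//.
  have [_ /(_ m x Sx) ->] := G1p; have [_ /(_ m x Sx) ->] := G2p.
  by rewrite -EFinM mulrC.
Qed.

Variables rho1 rho2 : 'rV[R]_d -> R.
Hypotheses (rho1_push : pushforward_density K G1 rhoT rho1)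
  (rho2_push : pushforward_density K G2 rhoT rho2).

(* The coupling is the image of the reference density under [(G1, G2)]. *)
Lemma le_W2_sqdist : (W2 rho1 rho2 <= sqrte (sqdist G1 G2))%E.
Proof.
(* The coupling is assembled from the affine pieces, which are measurable everywhere, while [G1] and
   [G2] are arbitrary outside K. *)
pose pair m w := (aff (A1 m) (b1 m) w, aff (A2 m) (b2 m) w).
have mpair m : measurable_fun [set: 'rV[R]_d] (pair m).
  by apply/measurable_fun_pairP; split; exact: measurable_aff.
pose mk m : {measure set ('rV[R]_d * 'rV[R]_d) -> \bar R} :=
  mscale (NngNum (r_ge0 m)) (pushforward_measure (mrestr leb (mS m)) (mpair m)).
(* [msum] is indexed by natural numbers, so the family is extended by the zero measure. *)
pose mn k : {measure set ('rV[R]_d * 'rV[R]_d) -> \bar R} :=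
  if insub k is Some m then mk m else mzero.
pose g : {measure set ('rV[R]_d * 'rV[R]_d) -> \bar R} := msum mn M.
have mnE (m : 'I_M) : mn m = mk m by rewrite /mn valK.
have gE E : g E = (\sum_m (r m)%:E * leb (pair m @^-1` E `&` S m))%E.
  by apply: eq_bigr => m _; rewrite mnE.
have g1 : g setT = 1%E.
  rewrite gE; under eq_bigr do rewrite preimage_setT setTI.
  exact: (sum_cell_mass d_gt0 T_decomp).
have [P PE] := measure_is_probability g1.
rewrite /W2 lee_sqrt ?sqdist_ge0//; apply: ereal_inf_lbound.
exists P.
  move=> E mE; rewrite PE !gE; split.
    rewrite (pushforward_mass d_gt0 T_decomp rhobar_P2ac G1p rho1_push)//.
    apply: eq_bigr => m _; congr (_ * leb (_ `&` _))%E.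
    by apply/seteqP; split => w //= -[].
  rewrite (pushforward_mass d_gt0 T_decomp rhobar_P2ac G2p rho2_push)//.
  apply: eq_bigr => m _; congr (_ * leb (_ `&` _))%E.
  by apply/seteqP; split => w //= -[].
pose cost (z : 'rV[R]_d * 'rV[R]_d) := (sqnorm (z.1 - z.2))%:E.
have mcost : measurable_fun [set: 'rV[R]_d * 'rV[R]_d] cost.
  by apply/measurable_EFinP; exact: measurable_sqnorm_sub.
have cost0 z : (0 <= cost z)%E by rewrite lee_fin sqnorm_ge0.
rewrite PE sqdistE ge0_integral_measure_sum//; last by move=> z _; exact: cost0.
apply: eq_bigr => m _; rewrite mnE /mk ge0_integral_mscale//=; last first.
  by move=> z _; exact: cost0.
congr (_ * _)%E.
rewrite ge0_integral_pushforward//; last by move=> z _; exact: cost0.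
rewrite preimage_setT ge0_integral_mrestr//; last by move=> x; exact: cost0.
by apply: measurableT_comp.
Qed.

Hypothesis G1_inj : set_inj K G1.
Variables (tau : R) (v : 'rV[R]_d -> 'rV[R]_d).
Hypothesis vE : forall x, (G1 @` K) x -> v x = tau^-1 *: (x - G2 (pinv K G1 x)).

(** At x = G1(w) the velocity is (x - G2(w)) / tau, because injectivity lets [pinv] recover w.
    Outside the image its arbitrary values meet a density that vanishes almost everywhere; the
    substitution x = G1(w) then gives the weighted distance. *)
Lemma integral_velocity :
  (\int[leb]_x (sqnorm (v x) * rho1 x)%:E = (tau^-1 ^+ 2)%:E * sqdist G1 G2)%E.
Proof.
have [N [mN N0 rhoE]] := pushforward_densityE d_gt0 T_decomp rhobar_P2ac
  K_supp G1p rho1_push.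
pose w m := aff_inv (A1 m) (b1 m).
pose psi m x := ((sqnorm (tau^-1 *: (x - aff (A2 m) (b2 m) (w m x)))
  * image_density T rhobar A1 m))%:E.
have c0 m : 0 <= image_density T rhobar A1 m.
  by have [dA _] := G1p; rewrite divr_ge0// ltW.
have mpsi m : measurable_fun [set: 'rV[R]_d] (psi m).
  apply/measurable_EFinP; apply: measurable_funM => //.
  under eq_fun do rewrite sqnormZ.
  apply: measurable_funM => //; apply: measurable_sqnorm_sub => //.
  by apply: measurableT_comp; [exact: measurable_aff|exact: measurable_aff_inv].
have psi0 m x : (0 <= psi m x)%E by rewrite lee_fin mulr_ge0 ?sqnorm_ge0.
transitivity (\int[leb]_x (\sum_m (psi m \_ (cell_image T A1 b1 m)) x))%E.
  apply: (eq_integral_off_null mN N0) => x _ Nx.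
  rewrite rhoE// mulr_sumr -sumEFin; apply: eq_bigr => m _.
  rewrite /patch indicE; case: ifPn => [/set_mem Qx|_]; last by rewrite !mulr0.
  have [Sw Gw] := cell_image_sub G1p Qx.
  have Kw : K (w m x) by exact: (simplex_sub T_decomp Sw).
  rewrite mulr1 vE; last by exists (w m x).
  rewrite /psi -{2}Gw pinvKV ?inE//.
  by have [_ /(_ m _ Sw) ->] := G2p.
rewrite (integral_cell_images T_decomp G1p)// sqdistE ge0_sume_distrr//;
  last first.
  by move=> m _; rewrite mule_ge0 ?lee_fin// integral_ge0// => x _;
    rewrite lee_fin sqnorm_ge0.
apply: eq_bigr => m _; have [dA _] := G1p.
transitivity ((\det (A1 m))%:E * \int[leb]_(x in S m)
    ((tau^-1 ^+ 2 * image_density T rhobar A1 m)%:E * (dist_ m x)%:E))%E.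
  congr (_ * _)%E; apply: eq_integral => x _; rewrite /psi /w affK// sqnormZ.
  by rewrite -EFinM; congr EFin; rewrite mulrAC.
rewrite ge0_integralZl_EFin//; last 3 first.
- by move=> x _; rewrite lee_fin sqnorm_ge0.
- by apply/measurable_EFinP; exact: measurable_funTS.
- by rewrite mulr_ge0// sqr_ge0.
rewrite !muleA -!EFinM; congr (_%:E * _)%E.
by rewrite mulrCA /image_density [_ * (_ / _)]mulrC divfK ?gt_eqF.
Qed.

End two_maps.

End couplings.

(** * Chains of maps and interpolation in time *)

Lemma sqr_sum_le (R : realDomainType) (I : Type) (s : seq I) (y : I -> R) :
  (\sum_(i <- s) y i) ^+ 2 <= (size s)%:R * \sum_(i <- s) y i ^+ 2.
Proof.
elim: s => [|i s IH]; first by rewrite !big_nil expr0n mul0r.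
rewrite !big_cons /=; move: IH.
set S := \sum_(j <- s) y j; set Q := \sum_(j <- s) y j ^+ 2; set k := size s.
case: s @k @S @Q => [|j s] k S Q IH.
  by rewrite /S /Q /k !big_nil !addr0 mul1r.
have k0 : 0 < k%:R :> R by [].
(* Expanding (S - k y)^2 >= 0 and using S^2 <= k Q bounds the cross term 2 S y by Q + k y^2. The
   empty list is split off so that k can be cancelled. *)
have H : 0 <= k%:R * (Q + k%:R * y i ^+ 2 - 2 * S * y i).
  apply: le_trans (sqr_ge0 (S - k%:R * y i)) _.
  rewrite -subr_ge0; set kk := k%:R in IH k0 *.
  rewrite (_ : _ - _ = kk * Q - S ^+ 2); last by ring.
  by rewrite subr_ge0.
rewrite pmulr_rge0// in H.
rewrite -natr1; set kk := k%:R in IH k0 H *; lra.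
Qed.

Lemma sqnorm_chain (R : realType) d (x : nat -> 'rV[R]_d) a c : (a <= c)%N ->
  sqnorm (x c - x a) <=
  (c - a)%:R * \sum_(a <= i < c) sqnorm (x i.+1 - x i).
Proof.
move=> ac; rewrite exchange_big/= mulr_sumr; apply: ler_sum => j _.
have -> : (x c - x a) ord0 j = \sum_(a <= i < c) (x i.+1 - x i) ord0 j.
  by rewrite -telescope_sumr// summxE.
by apply: le_trans (sqr_sum_le _ _) _; rewrite size_iota.
Qed.

Lemma sqrtD_le (R : rcfType) (x y : R) : 0 <= x -> 0 <= y ->
  Num.sqrt (x + y) <= Num.sqrt x + Num.sqrt y.
Proof.
move=> x0 y0; rewrite -[leRHS]ger0_norm ?addr_ge0 ?sqrtr_ge0// -sqrtr_sqr.
rewrite ler_sqrt ?sqr_ge0// sqrrD !sqr_sqrtr// -addrA lerD2l lerDr.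
by rewrite mulrn_wge0// mulr_ge0 ?sqrtr_ge0.
Qed.

Section sqdist_chain.
Context (R : realType) (d M : nat) (d_gt0 : (0 < d)%N).
Variables (K : set 'rV[R]_d) (T : 'I_M -> 'I_d.+1 -> 'rV[R]_d).
Hypothesis T_decomp : simplicial_decomposition K T.
Variable rhobar : 'rV[R]_d -> R.
Hypothesis rhobar_P2ac : P2ac rhobar.
Variable G : nat -> 'rV[R]_d -> 'rV[R]_d.
Hypothesis G_adm : forall n, admissible_map K T (G n).
Local Notation dist := (sqdist K T rhobar).

(** The pointwise bound [sqnorm_chain], along the positions of one reference point, is integrated
    over each simplex. *)
Lemma sqdist_chain a c : (a <= c)%N ->
  (dist (G c) (G a) <= (c - a)%:R%:E * \sum_(a <= i < c) dist (G i.+1) (G i))%E.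
Proof.
move=> ac.
have [A GA] := choice (fun n => admissible_pieces (G_adm n)).
have [b Gp] := choice GA.
have distE i k := sqdistE d_gt0 T_decomp rhobar_P2ac (Gp i) (Gp k).
under eq_bigr do rewrite distE.
rewrite distE.
pose D i m w := sqnorm (aff (A i.+1 m) (b i.+1 m) w - aff (A i m) (b i m) w).
have mD i m : measurable_fun [set: 'rV[R]_d] (D i m).
  by apply: measurable_sqnorm_sub; exact: measurable_aff.
have mS m : measurable (simplex (T m)) by exact: (measurable_piece T_decomp).
have r0 m : 0 <= cell_density T rhobar m by exact: cell_density_ge0.
have I0 i m : (0 <= \int[lebesgue_rV R d]_(w in simplex (T m)) (D i m w)%:E)%E.
  by apply: integral_ge0 => w _; rewrite lee_fin sqnorm_ge0.
rewrite exchange_big/= ge0_sume_distrr; last first.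
  move=> m _; apply: sume_ge0 => i _; apply: mule_ge0; first by rewrite lee_fin.
  exact: I0.
apply: lee_sum => m _; rewrite -ge0_sume_distrr; last by move=> i _; exact: I0.
rewrite muleCA lee_wpmul2l ?lee_fin//.
rewrite -ge0_integral_sum//; last 2 first.
- by move=> i; apply/measurable_EFinP; exact: measurable_funTS (mD i m).
- by move=> i w _; rewrite lee_fin sqnorm_ge0.
rewrite -ge0_integralZl_EFin//; last 2 first.
- by move=> w _; apply: sume_ge0 => i _; rewrite lee_fin sqnorm_ge0.
- by apply: emeasurable_sum => i; apply/measurable_EFinP;
    exact: measurable_funTS (mD i m).
apply: ge0_le_integral_gen => w _; first by rewrite lee_fin sqnorm_ge0.
rewrite sumEFin -EFinM lee_fin.
exact: (sqnorm_chain (fun i => aff (A i m) (b i m) w)).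
Qed.

End sqdist_chain.

Section interpolation_index.
Context (R : realType) (tau : R) (tau_gt0 : 0 < tau).

Definition step_index (t : R) : nat := `|Num.ceil (t / tau)|%N.

Lemma step_indexE t : 0 <= t -> (step_index t)%:R = (Num.ceil (t / tau))%:~R :> R.
Proof.
move=> t0; rewrite /step_index natr_absz ger0_norm//.
by rewrite ceil_ge0 (lt_le_trans _ (divr_ge0 t0 (ltW tau_gt0)))// oppr_lt0.
Qed.

Lemma step_index_lb t : 0 <= t -> t <= (step_index t)%:R * tau.
Proof. by move=> t0; rewrite step_indexE// -ler_pdivrMr// ceil_ge. Qed.

Lemma step_index_ub t : 0 <= t -> (step_index t)%:R * tau < t + tau.
Proof.
move=> t0; rewrite step_indexE//.
have := ceilB1_lt (t / tau); rewrite ltr_pdivlMr// intrB mulrBl mul1r.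
by rewrite ltrBlDr.
Qed.

Lemma step_index_le s t : 0 <= s -> s <= t -> (step_index s <= step_index t)%N.
Proof.
move=> s0 st; apply: unstable.lez_abs2;
  last by rewrite le_ceil// ler_pM2r ?invr_gt0.
by rewrite ceil_ge0 (lt_le_trans _ (divr_ge0 s0 (ltW tau_gt0)))// oppr_lt0.
Qed.

Lemma step_index_gt0 t : 0 < t -> (0 < step_index t)%N.
Proof.
move=> t0; have := step_index_lb (ltW t0).
by case: step_index => //; rewrite mul0r leNgt t0.
Qed.

(** Index 0 occurs only at time 0, a null set, so [F 0] never enters. The last step may reach beyond
    [T0], which costs only an inequality. *)
Lemma integral_step_le (F : nat -> \bar R) (T0 : R) : (forall n, 0 <= F n)%E ->
  0 < T0 -> (\int[lebesgue_measure]_(t in `[0%R, T0]) F (step_index t) <=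
    tau%:E * \sum_(0 <= i < step_index T0) F i.+1)%E.
Proof.
move=> F0 T0_gt0; set N := step_index T0.
pose I i : set (measurableTypeR R) := `](i%:R * tau), (i.+1%:R * tau)]%classic.
have mI i : measurable (I i) by exact: measurable_itv.
have m1 : measurable ([set 0] : set (measurableTypeR R)) by exact:
  measurable_set1.
apply: (@le_trans _ _ (\int[lebesgue_measure]_(t in `[0%R, T0])
    \sum_(i < N) (F i.+1 * (\1_(I i) t)%:E))%E).
  apply: (ge0_le_integral_off_null m1 (lebesgue_measure_set1 _)) => //.
    move=> t _; apply: sume_ge0 => i _.
    by rewrite mule_ge0// lee_fin.
  move=> t /=; rewrite in_itv/= => /andP[t0 tT] /eqP tn0.
  have t_gt0 : 0 < t by rewrite lt_neqAle eq_sym tn0.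
  have k0 := step_index_gt0 t_gt0.
  have kN : ((step_index t).-1 < N)%N by rewrite prednK// step_index_le.
  rewrite (bigD1 (Ordinal kN))//= prednK//.
  rewrite indicE mem_set ?mule1.
    by rewrite leeDl// sume_ge0// => i _; rewrite mule_ge0// lee_fin.
  rewrite /I /= in_itv/= prednK// step_index_lb// andbT.
  have := step_index_ub t0;
    rewrite -[in X in X -> _](prednK k0) -natr1 mulrDl mul1r.
  by rewrite ltrD2r.
rewrite big_mkord ge0_sume_distrr//.
have mind i : measurable_fun (`[0%R, T0] : set (measurableTypeR R)) (fun t =>
  (\1_(I i) t)%:E : \bar R).
  by apply/measurable_EFinP; exact: measurable_indic.
rewrite ge0_integral_sum//; last 2 first.
- by move=> i; apply: measurable_funeM; exact: mind.
- by move=> i t _; rewrite mule_ge0// lee_fin.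
apply: lee_sum => i _; rewrite ge0_integralZl//.
rewrite muleC lee_wpmul2r// integral_indic//.
apply: (@le_trans _ _ (lebesgue_measure (I i))).
  by apply: le_measure; rewrite ?inE//; exact: measurableI.
rewrite lebesgue_measure_itv/= lte_fin -EFinB; case: ifPn => _.
  by rewrite lee_fin -natr1; lra.
by rewrite lee_fin ltW.
Qed.

End interpolation_index.

(** * The discrete energy inequality and its consequences *)

Theorem lemma4p1 (R : realType) (d : nat) (d_ge2 : (2 <= d)%N)
    (h : R -> R) (h_adm : internal_energy_density h)
    (V : 'rV[R]_d -> R) (V_C2 : C2_fun V) (V_ge0 : forall x, 0 <= V x)
    (rhobar : 'rV[R]_d -> R) (rhobar_P2ac : P2ac rhobar)
    (K : set 'rV[R]_d) (K_supp : K = support_density rhobar)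
    (K_convex : convex_set K) (K_compact : compact K)
    (M : nat) (T : 'I_M -> 'I_d.+1 -> 'rV[R]_d)
    (T_decomp : simplicial_decomposition K T)
    (tau : R) (tau_gt0 : 0 < tau)
    (G : nat -> 'rV[R]_d -> 'rV[R]_d)
    (G_adm : forall n, admissible_map K T (G n))
    (G_min : forall n, (0 < n)%N -> forall F, admissible_map K T F ->
       (step_functional h V K (discrete_density T rhobar) tau
          (G n) (G n.-1) <=
        step_functional h V K (discrete_density T rhobar) tau
          F (G n.-1))%E)
    (G_inj : forall n, (0 < n)%N -> set_inj K (G n))
    (rho : nat -> 'rV[R]_d -> R)
    (rho_push : forall n,
       pushforward_density K (G n) (discrete_density T rhobar) (rho n))
    (v : nat -> 'rV[R]_d -> 'rV[R]_d)
    (v_def : forall n, (0 < n)%N -> forall x, (G n @` K) x ->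
       v n x = tau^-1 *: (x - G n.-1 (pinv K (G n) x))) :
  let rhot := interpolation tau rho in
  let vt := interpolation tau v in
  [/\ forall n1 n2 : nat, (n1 < n2)%N ->
        (entropy h V (rho n2) +
         (tau / 2)%:E *
           \sum_(n1.+1 <= n < n2.+1) (W2 (rho n) (rho n.-1) * (tau^-1)%:E) ^+ 2
         <= entropy h V (rho n1))%E,
      forall s t, 0 <= s -> s <= t ->
        (entropy h V (rhot t) <= entropy h V (rhot s))%E,
      forall s t, 0 <= s -> s <= t ->
        (W2 (rhot t) (rhot s) <=
         sqrte (2%:E * entropy h V (rho 0%N)) *
         (Num.sqrt `|t - s| + Num.sqrt tau)%:E)%E &
      forall T0 : R, 0 < T0 ->
        (\int[lebesgue_measure]_(t in `[0%R, T0])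
           \int[lebesgue_rV R d]_x (sqnorm (vt t x) * rhot t x)%:E
         <= 2%:E * entropy h V (rho 0%N))%E].
Proof.
move=> rhot vt.
have d_gt0 : (0 < d)%N by exact: leq_trans d_ge2.
have [_ h_ge0 h_conv h0 _] := h_adm.
have mV : measurable_fun [set: 'rV[R]_d] V.
  by have [V1 _] := V_C2; exact: C1_fun_measurable.
pose E n := transformed_entropy h V K (discrete_density T rhobar) (G n).
pose D i := sqdist K T rhobar (G i.+1) (G i).
have D_ge0 i : (0 <= D i)%E by exact: sqdist_ge0.
have tau2_ge0 : 0 <= (2 * tau)^-1 by rewrite invr_ge0 mulr_ge0// ltW.
have ent_ge0 n : (0 <= entropy h V (rho n))%E.
  exact: entropy_ge0 (rho_push n) _ _ _ _.
have E_le n : (E n <= entropy h V (rho n))%E.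
  have [A [b Gp]] := admissible_pieces (G_adm n).
  exact: (le_entropy d_gt0 T_decomp rhobar_P2ac K_supp Gp (rho_push n)).
have E_eq n : (0 < n)%N -> entropy h V (rho n) = E n.
  move=> n0; have [A [b Gp]] := admissible_pieces (G_adm n).
  apply: (entropyE d_gt0 T_decomp rhobar_P2ac K_supp Gp (rho_push n)) => //.
  exact: G_inj.
have E_step i : ((2 * tau)^-1%:E * D i + E i.+1 <= E i)%E.
  have := G_min i.+1 isT (G i) (G_adm i); rewrite /step_functional /=.
  rewrite -/(sqdist K T rhobar (G i.+1) (G i)) -/(sqdist K T rhobar (G i) (G i)).
  by rewrite sqdist_self mule0 add0e.
have E_tele n1 n2 : (n1 <= n2)%N ->
    (E n2 + (2 * tau)^-1%:E * \sum_(n1 <= i < n2) D i <= E n1)%E.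
  elim: n2 => [|n2 IH]; first by rewrite leqn0 => /eqP ->;
    rewrite big_geq// mule0 adde0.
  rewrite leq_eqVlt => /predU1P[->|]; first by rewrite big_geq// mule0 adde0.
  rewrite ltnS => n12; apply: le_trans (IH n12).
  rewrite big_nat_recr//= ge0_muleDr// ?sume_ge0//.
  by rewrite addeA addeAC leeD2r// addeC E_step.
(* The later index is positive unless both are 0, so the equality [E_eq] is available where the
   entropy must be bounded above; at the earlier index [E_le] is enough. *)
have main n1 n2 : (n1 <= n2)%N ->
    (entropy h V (rho n2) + (2 * tau)^-1%:E * \sum_(n1 <= i < n2) D i <=
     entropy h V (rho n1))%E.
  case: n2 => [|n2] n12.
    by move: n12; rewrite leqn0 => /eqP ->; rewrite big_geq// mule0 adde0.
  by rewrite E_eq//; apply: le_trans (E_tele _ _ n12) (E_le n1).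
have mono n1 n2 : (n1 <= n2)%N ->
    (entropy h V (rho n2) <= entropy h V (rho n1))%E.
  move=> n12; apply: le_trans (main _ _ n12).
  by rewrite leeDl// mule_ge0// ?lee_fin// sume_ge0.
have sumD n1 n2 : (n1 <= n2)%N ->
    (\sum_(n1 <= i < n2) D i <= (2 * tau)%:E * entropy h V (rho 0%N))%E.
  move=> n12; have := le_trans (main _ _ n12) (mono 0%N n1 (leq0n _)).
  move=> /(le_trans (leeDr _ (ent_ge0 n2))) H.
  have t0 : 0 <= 2 * tau by rewrite mulr_ge0// ltW.
  have := @lee_wpmul2l _ (2 * tau)%:E _ _ _ H; rewrite lee_fin => /(_ t0).
  rewrite muleA -EFinM divff ?mul1e// mulf_neq0 ?pnatr_eq0//.
  by rewrite gt_eqF.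
have W2_le a c : (W2 (rho a) (rho c) <= sqrte (sqdist K T rhobar (G a) (G c)))%E.
  have [A [b Gp]] := admissible_pieces (G_adm a).
  have [A' [b' Gp']] := admissible_pieces (G_adm c).
  exact: (le_W2_sqdist d_gt0 T_decomp rhobar_P2ac K_supp Gp Gp' (rho_push a)
    (rho_push c)).
split.
- move=> n1 n2 n12; apply: le_trans (main _ _ (ltnW n12)).
  rewrite leeD2l// big_add1/=.
  have W_ge0 i : (0 <= (W2 (rho i.+1) (rho i) * tau^-1%:E) ^+ 2)%E.
    by rewrite expe2; apply: mule_ge0; apply: mule_ge0;
      rewrite ?sqrte_ge0// lee_fin invr_ge0 ltW.
  rewrite !ge0_sume_distrr//; last by move=> i _; exact: W_ge0.
  apply: lee_sum => i _.
  (* (tau / 2) tau^-2 is the weight 1 / (2 tau) of the time-step functional. *)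
  apply: (@le_trans _ _ ((tau / 2)%:E * ((tau^-1 ^+ 2)%:E * D i))%E); last first.
    by rewrite muleA -EFinM le_eqVlt; apply/orP; left; apply/eqP;
      congr (_%:E * _)%E; field; rewrite gt_eqF.
  apply: lee_wpmul2l; first by rewrite lee_fin divr_ge0// ltW.
  rewrite muleACA -EFinM muleC -expr2.
  rewrite lee_wpmul2l ?lee_fin ?sqr_ge0// -[leRHS]sqr_sqrte// expe2.
  by rewrite lee_pmul ?sqrte_ge0 ?W2_le.
- move=> s t s0 st; apply: mono; exact: step_index_le.
- move=> s t s0 st.
  have t0 : 0 <= t by exact: le_trans st.
  have ab := step_index_le tau_gt0 s0 st.
  rewrite /rhot /interpolation -/(step_index tau s) -/(step_index tau t).
  apply: (le_trans (W2_le _ _)).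
  have N0 : (0 <= 2%:E * entropy h V (rho 0%N))%E by rewrite mule_ge0.
  have st0 : 0 <= `|t - s| + tau by rewrite addr_ge0// ltW.
  (* With m and n the indices of s and t, n tau < t + tau and s <= m tau give (n - m) tau <= |t - s|
     + tau. The factor n - m from Cauchy-Schwarz meets the tau in the bound on the squared steps. *)
  apply: (@le_trans _ _ (sqrte (2%:E * entropy h V (rho 0%N)) * sqrte (`|t -
    s| + tau)%:E)%E); last first.
    by rewrite lee_wpmul2l ?sqrte_ge0//= lee_fin sqrtD_le// ltW.
  rewrite -sqrteM// lee_sqrt ?mule_ge0// ?lee_fin//.
  apply: (le_trans (sqdist_chain d_gt0 T_decomp rhobar_P2ac G_adm ab)).
  apply: (@le_trans _ _ ((step_index tau t - step_index tau s)%:R%:E *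
      ((2 * tau)%:E * entropy h V (rho 0%N)))%E).
    by rewrite lee_wpmul2l ?lee_fin// sumD.
  rewrite !muleA -EFinM [leRHS]muleAC -EFinM lee_wpmul2r//.
  rewrite lee_fin natrB// (ger0_norm (_ : 0 <= t - s)) ?subr_ge0//.
  have := step_index_ub tau_gt0 t0; have := step_index_lb tau_gt0 s0; lra.
- move=> T0 T0_gt0.
  pose F n := (\int[lebesgue_rV R d]_x (sqnorm (v n x) * rho n x)%:E)%E.
  have F0 n : (0 <= F n)%E.
    have [_ rho0 _] := rho_push n.
    by apply: integral_ge0 => x _; rewrite lee_fin mulr_ge0 ?sqnorm_ge0.
  have FE i : F i.+1 = ((tau^-1 ^+ 2)%:E * D i)%E.
    have [A [b Gp]] := admissible_pieces (G_adm i.+1).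
    have [A' [b' Gp']] := admissible_pieces (G_adm i).
    apply: (integral_velocity d_gt0 T_decomp rhobar_P2ac K_supp Gp Gp'
      (rho_push i.+1)).
      exact: G_inj.
    by move=> x Gx; rewrite v_def.
  apply: (le_trans (integral_step_le tau_gt0 F0 T0_gt0)).
  under eq_bigr do rewrite FE.
  rewrite -ge0_sume_distrr// muleA -EFinM.
  (* The step length tau, the factor tau^-2 of the squared velocity and the bound 2 tau on the
     squared steps multiply to 2. *)
  apply: (@le_trans _ _ ((tau * tau^-1 ^+ 2)%:E * ((2 * tau)%:E * entropy h V
    (rho 0%N)))%E).
    by rewrite lee_wpmul2l ?sumD// lee_fin mulr_ge0 ?sqr_ge0// ltW.
  rewrite muleA -EFinM le_eqVlt; apply/orP; left; apply/eqP; congr (_%:E * _)%E.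
  by field; rewrite gt_eqF.
Qed.
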